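(* For $0<\sigma<2$ let $L^\sigma$ be the probability density on $\mathbb{R}$ whose Fourier transform is $\widehat{L^\sigma}(\xi)=e^{-|\xi|^\sigma}$, and for $y>0$ let $L^\sigma_y(x)=y^{-1}L^\sigma(y^{-1}x)$. Then the maximal operator \[L^*f(x)=\sup_{y>0,\,0<\sigma<2}|(L^\sigma_y\ast f)(x)|\] is of weak type $(1,1)$ on $\mathbb{R}$ and bounded on $L^p(\mathbb{R})$ for $1<p\leq\infty$.
   Context: An operator $T$ is of weak type $(1,1)$ if there is $C>0$ with $|\{x:|Tf(x)|>\lambda\}|\leq C\lambda^{-1}\|f\|_1$ for all $f\in L^1(\mathbb{R})$ and $\lambda>0$; it is bounded on $L^p$ if $\|Tf\|_p\leq C\|f\|_p$. *)

(* Defs.v *)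
From HB Require Import structures.
From mathcomp Require Import all_boot all_order all_algebra.
From mathcomp Require Import all_classical all_reals all_analysis.
Set Implicit Arguments. Unset Strict Implicit. Unset Printing Implicit Defensive.
Import Order.TTheory GRing.Theory Num.Theory.
Local Open Scope classical_set_scope.
Local Open Scope ring_scope.

(* [is_stable_density L s] : L is a probability density on R whose Fourier
   transform  \int L(x) e^{-i x xi} dx  equals  e^{-|xi|^s}.  The complex
   Fourier identity is split into its real and imaginary parts. *)
Definition is_stable_density {R : realType} (s : R) (L : R -> R) : Prop :=
  [/\ forall x, 0 <= L x,
      measurable_fun setT L,
      (\int[lebesgue_measure]_x (L x)%:E = 1)%E &
      forall xi : R,
        (\int[lebesgue_measure]_x (L x * cos (x * xi))%:E
           = (expR (- (`|xi| `^ s)))%:E)%E /\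
        (\int[lebesgue_measure]_x (L x * sin (x * xi))%:E = 0)%E].

Definition stable_conv {R : realType} (L : R -> R -> R) (s y : R)
  (f : R -> R) (x : R) : \bar R :=
  (\int[lebesgue_measure]_t ((y^-1 * L s ((x - t) / y)) * f t)%:E)%E.

Definition Lstar {R : realType} (L : R -> R -> R) (f : R -> R) (x : R)
  : \bar R :=
  ereal_sup [set e | exists y s, [/\ 0 < y, 0 < s, s < 2 &
                     e = `| stable_conv L s y f x |%E]].

(* Main.v *)
(* Every [L^s] is, up to a universal factor, dominated by radially decreasing
   kernels of bounded mass, hence [Lstar f] is dominated pointwise by the
   Hardy-Littlewood maximal function of [f], uniformly in [s].

   To see this, smooth [L^s] by a Gaussian [G_d]: the result is the Fourier
   transform of [exp (- d xi^2) exp (- |xi|^s)].  Expanding [(1 - x)^(s/2)] in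
   its binomial series, whose nonconstant coefficients are nonpositive, and
   putting [x = exp (- xi^2 / l)], one finds
     [|xi|^s = lim_l l^(s/2) (1 - exp (- xi^2 / l))^(s/2)],
   so that [exp (- |xi|^s)] is a limit of nonnegative combinations of Gaussians
   and [L^s * G_d] is radially decreasing.  As [d] tends to [0], Lebesgue's
   differentiation theorem bounds [L^s] by a multiple of the lower limit of
   these kernels, and Fatou's lemma concludes. *)
Require Import Defs.
From HB Require Import structures.
From mathcomp Require Import all_boot all_order all_algebra.
From mathcomp Require Import all_classical all_reals all_analysis.
From mathcomp Require Import measurable_realfun ess_sup_inf.
From mathcomp Require Import ring lra.
Import Order.TTheory GRing.Theory Num.Theory.
Import numFieldNormedType.Exports.
Local Open Scope classical_set_scope.
Local Open Scope ring_scope.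

(** * Affine changes of variables *)

(** A stable density is given only through its Fourier transform, hence only up to a null set, so
    pointwise monotonicity cannot be asked of it; and writing it as a mixture of Gaussians would
    require the mixing law. The Gaussian damping answers both. It makes the inversion integral
    absolutely convergent, so that monotonicity can be tested on symbols, and Fubini identifies the
    result with 2 pi times a smoothing of the density. Uniformity in [s] and [y] has three sources:
    the mass 2 pi of the smoothed kernel depends neither on [s] nor on [d]; a Gaussian of width [r]
    dominates a fixed multiple of the mean over the ball of radius [r]; and the substitution t = x -
    y u removes [y]. For finite p > 1 the norm bound is that of the Hardy-Littlewood operator,
    deduced from its weak type inequality by a dyadic form of Marcinkiewicz interpolation; for p =
    oo every mean of |f| is bounded by the essential supremum. *)

Section affine_change_of_variables.
Context {R : realType}.
Local Notation mu := (@lebesgue_measure R).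

Lemma measurable_affine (a b : R) :
  measurable_fun [set: R] (fun x : R => a * x + b).
Proof. by apply: measurable_funD => //; exact: measurable_funM. Qed.

Let affine (a b : R) (x : measurableTypeR R) : measurableTypeR R := a * x + b.

(** Both sides are measures in [A], so by uniqueness of Lebesgue measure half-open intervals
    suffice. A negative [a] exchanges the open and the closed end of the preimage, hence the two
    cases. *)
Let lebesgue_measure_affine (a b : R) (a0 : a != 0) (A : set R) :
  measurable A -> mu A = (`|a|%:E * pushforward mu (affine a b) A)%E.
Proof.
move=> mA.
apply: (@lebesgue_measure_unique R (mscale (NngNum (normr_ge0 a))
  (pushforward mu (affine a b)))) => //=.
  exact: measurable_affine.
move=> ? _ [[c d]] _ <- /=.
rewrite /mscale/= /pushforward lebesgue_measure_itv/= lte_fin.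
have [ap|an|ae] := ltgtP 0 a; last by rewrite -ae eqxx in a0.
- rewrite (_ : affine a b @^-1` _ =
      `](c - b) / a, (d - b) / a]%classic); last first.
    have E (x : R) : (c < a * x + b <= d) = ((c - b) / a < x <= (d - b) / a).
      by rewrite ltr_pdivrMr// ler_pdivlMr// ltrBlDr lerBrDr (mulrC a).
    apply/seteqP; split => x /=; rewrite !in_itv/= => h; first by rewrite -E; exact: h.
    by have := h; rewrite -E; exact: id.
  rewrite lebesgue_measure_itv/= lte_fin gtr0_norm// ltr_pM2r ?invr_gt0//.
  rewrite ltrD2r; case: ifPn => cd; last by rewrite mule0.
  by rewrite -EFinB -EFinM; congr EFin; field; rewrite gt_eqF.
- rewrite (_ : affine a b @^-1` _ =
      `[(d - b) / a, (c - b) / a[%classic); last first.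
    have E (x : R) : (c < a * x + b <= d) = ((d - b) / a <= x < (c - b) / a).
      by rewrite ler_ndivrMr// ltr_ndivlMr// ltrBlDr lerBrDr (mulrC a) andbC.
    apply/seteqP; split => x /=; rewrite !in_itv/= => h; first by rewrite -E; exact: h.
    by have := h; rewrite -E; exact: id.
  rewrite lebesgue_measure_itv/= lte_fin ltr0_norm// ltr_nM2r ?invr_lt0//.
  rewrite ltrD2r; case: ifPn => cd; last by rewrite mule0.
  by rewrite -EFinB -EFinM; congr EFin; field; rewrite lt_eqF.
Qed.

Lemma ge0_integral_affine (a b : R) (f : R -> \bar R) : a != 0 ->
  measurable_fun setT f -> (forall x, 0 <= f x)%E ->
  (\int[mu]_x f x = `|a|%:E * \int[mu]_x f (a * x + b)%R)%E.
Proof.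
move=> a0 mf f0.
have ma : measurable_fun setT (affine a b) := measurable_affine a b.
have := @ge0_integral_pushforward _ _ _ _ R (affine a b) ma mu setT f
  measurableT mf (fun x _ => f0 x).
rewrite preimage_setT /= => <-.
pose P := measure_function_pushforward__canonical__measure_function_Measure
  mu ma.
pose k := NngNum (normr_ge0 a).
transitivity (\int[mscale k P]_x f x)%E; last first.
  by apply: (@ge0_integral_mscale _ _ R P setT measurableT k f).
apply: eq_measure_integral => A mA _.
exact: lebesgue_measure_affine.
Qed.

End affine_change_of_variables.
(** * Gaussians and their Fourier transforms *)

Section gauss.
Context {R : realType}.
Local Notation mu := (@lebesgue_measure R).

Definition gauss (a x : R) : R := expR (- (a * x ^+ 2)).

Lemma gauss_ge0 a x : 0 <= gauss a x. Proof. exact: expR_ge0. Qed.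

Lemma gauss_le1 a x : 0 <= a -> gauss a x <= 1.
Proof. by move=> a0; rewrite -expR0 ler_expR lerNl oppr0 mulr_ge0 ?sqr_ge0. Qed.

Lemma gaussD a b x : gauss (a + b) x = gauss a x * gauss b x.
Proof. by rewrite /gauss -expRD mulrDl opprD. Qed.

Lemma gauss_is_derive (a x : R) :
  is_derive x 1 (gauss a) (- (2 * a * x) * gauss a x).
Proof.
have d1 : is_derive x 1 (fun z : R => - (a * z ^+ 2)) (- (2 * a * x)).
  by apply: is_derive_eq; rewrite /GRing.scale /=; ring.
by apply: is_derive_eq; rewrite /gauss; ring.
Qed.

Lemma continuous_gauss a : continuous (gauss a).
Proof.
move=> x; apply: differentiable_continuous; apply/derivable1_diffP.
by have [] := gauss_is_derive a x.
Qed.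

Lemma measurable_gauss a : measurable_fun setT (gauss a).
Proof. by apply: continuous_measurable_fun; exact: continuous_gauss. Qed.

Lemma integral_gauss (a : R) : 0 < a ->
  (\int[mu]_x (gauss a x)%:E = (Num.sqrt pi / Num.sqrt a)%:E)%E.
Proof.
move=> a0.
have s0 : 0 < Num.sqrt a by rewrite sqrtr_gt0.
have := @ge0_integral_affine R (Num.sqrt a) 0 (EFin \o gauss_fun).
rewrite integralT_gauss gt_eqF// => /(_ isT) E.
have {}E : ((Num.sqrt pi)%:E = (Num.sqrt a)%:E * \int[mu]_x (gauss a x)%:E)%E.
  rewrite E; last 2 first.
  - by apply/measurable_EFinP; exact: measurable_gauss_fun.
  - by move=> x; rewrite lee_fin gauss_fun_ge0.
  rewrite gtr0_norm//; congr (_ * _)%E; apply: eq_integral => x _ /=.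
  by rewrite addr0 /gauss_fun /gauss exprMn sqr_sqrtr// ltW.
rewrite mulrC EFinM E muleA -EFinM mulVf ?mul1e// gt_eqF//.
Qed.

Lemma integrable_gauss (a : R) : 0 < a -> mu.-integrable setT (EFin \o gauss a).
Proof.
move=> a0; apply/integrableP; split.
  by apply/measurable_EFinP; exact: measurable_gauss.
under eq_integral do rewrite gee0_abs ?lee_fin ?gauss_ge0//.
by rewrite integral_gauss// ltry.
Qed.

Lemma integrable_gaussM (a C : R) (phi : R -> R) : 0 < a ->
  measurable_fun setT phi -> (forall x, `|phi x| <= C) ->
  mu.-integrable setT (fun x => (gauss a x * phi x)%:E).
Proof.
move=> a0 mphi phiC.
apply: (@le_integrable _ _ R mu setT measurableT _
  (fun x => (C%:E * (gauss a x)%:E)%E)).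
- by apply/measurable_EFinP; apply: measurable_funM => //; exact: measurable_gauss.
- move=> x _; rewrite /= lee_fin normrM ger0_norm ?gauss_ge0// mulrC.
  have phiCx := phiC x; rewrite [leRHS]ger0_norm ?mulr_ge0 ?gauss_ge0//.
    by apply: ler_wpM2r => //; exact: gauss_ge0.
  exact: le_trans phiCx.
- by apply: integrableZl => //; exact: integrable_gauss.
Qed.

(** Half of the exponent pays for the factor |x|: |x| <= 1 + x^2 <= (1 + 2/a) (1 + a x^2 / 2) <= (1
    + 2/a) exp (a x^2 / 2). *)
Lemma norm_id_gauss_le (a x : R) : 0 < a ->
  `|x| * gauss a x <= (1 + 2 / a) * gauss (a / 2) x.
Proof.
move=> a0; rewrite {1}(_ : a = a / 2 + a / 2); last by field.
rewrite gaussD mulrA; apply: ler_wpM2r; first exact: gauss_ge0.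
rewrite /gauss expRN ler_pdivrMr ?expR_gt0//.
have h : 1 + a / 2 * x ^+ 2 <= expR (a / 2 * x ^+ 2) by exact: expR_ge1Dx.
have ai : 0 < a^-1 by rewrite invr_gt0.
apply: (@le_trans _ _ ((1 + 2 / a) * (1 + a / 2 * x ^+ 2))); last first.
  by apply: ler_wpM2l => //; rewrite addr_ge0// mulr_ge0// ltW.
rewrite (_ : (1 + 2 / a) * _ = 1 + x ^+ 2 + 2 / a + a / 2 * x ^+ 2); last first.
  by field; rewrite gt_eqF.
have : 0 <= 2 / a by rewrite mulr_ge0// ltW.
have : 0 <= a / 2 * x ^+ 2 by rewrite mulr_ge0// ?sqr_ge0// divr_ge0// ltW.
have : `|x| <= 1 + x ^+ 2.
  by rewrite -(real_normK (num_real x)); have := normr_ge0 x; nra.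
lra.
Qed.

Lemma integrable_id_gaussM (a C : R) (phi : R -> R) : 0 < a ->
  measurable_fun setT phi -> (forall x, `|phi x| <= C) ->
  mu.-integrable setT (fun x => (x * gauss a x * phi x)%:E).
Proof.
move=> a0 mphi phiC.
have a20 : 0 < a / 2 by rewrite divr_gt0.
have k0 : 0 <= 1 + 2 / a by rewrite addr_ge0// divr_ge0// ltW.
apply: (@le_integrable _ _ R mu setT measurableT _
  (fun x => ((C * (1 + 2 / a))%:E * (gauss (a / 2) x)%:E)%E)).
- apply/measurable_EFinP; apply: measurable_funM => //.
  by apply: measurable_funM => //; exact: measurable_gauss.
- move=> x _; have C0 : 0 <= C := le_trans (normr_ge0 _) (phiC x).
  rewrite /= lee_fin normrM [leRHS]ger0_norm; last first.
    by rewrite !mulr_ge0 ?gauss_ge0.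
  rewrite [leLHS]mulrC -[leRHS]mulrA; apply: ler_pM => //.
  by rewrite normrM (ger0_norm (gauss_ge0 _ _)) norm_id_gauss_le.
- by apply: integrableZl => //; exact: integrable_gauss.
Qed.

End gauss.

(** * The transform of a Gaussian through its differential equation *)

Section gauss_fourier.
Context {R : realType}.
Local Notation mu := (@lebesgue_measure R).

Lemma cvg_Rintegral_dominated (f_ : (R -> R)^nat) (f g : R -> R) :
  (forall n, measurable_fun setT (f_ n)) -> measurable_fun setT f ->
  {ae mu, forall x, f_ ^~ x @ \oo --> f x} ->
  mu.-integrable setT (EFin \o g) -> (forall n x, `|f_ n x| <= g x) ->
  (\int[mu]_x f_ n x @[n --> \oo] --> \int[mu]_x f x)%R.
Proof.
move=> mf_ mf f_f ig f_g.
have [] := @dominated_convergence _ _ R mu setT measurableT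
  (fun n => EFin \o f_ n) (EFin \o f) (EFin \o g).
- by move=> n; apply/measurable_EFinP; exact: mf_.
- by apply/measurable_EFinP; exact: mf.
- apply: (@filterS _ _ (ae_filter_ringOfSetsType mu)) f_f => x h _.
  exact: (cvg_comp _ _ h).
- exact: ig.
- by apply: aeW => x n _; rewrite /= lee_fin.
move=> intf _ h; rewrite /Rintegral.
have fi : (\int[mu]_x (EFin \o f) x)%E \is a fin_num by exact: integrable_fin_num.
by apply/fine_cvg; rewrite fineK.
Qed.

(** This is integration by parts on the line: on [-(n+1), n+1] the fundamental theorem leaves only
    boundary terms, and dominated convergence with majorant |h'| lets the interval grow. *)
Lemma Rintegral_is_derive_eq0 (h h' : R -> R) :
  (forall x : R, is_derive x 1 h (h' x)) -> continuous h' ->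
  mu.-integrable setT (EFin \o h') ->
  h n.+1%:R @[n --> \oo] --> (0:R) -> h (- n.+1%:R) @[n --> \oo] --> (0:R) ->
  (\int[mu]_x h' x)%R = 0.
Proof.
move=> dh ch ih h1 h2.
have mh : measurable_fun setT h' by exact: continuous_measurable_fun.
pose I (n : nat) : set R := `[- n.+1%:R, n.+1%:R]%classic.
have mI n : measurable (I n) by exact: measurable_itv.
have ch' : continuous h.
  move=> x; apply: differentiable_continuous; apply/derivable1_diffP.
  by have [] := dh x.
have E n : (\int[mu]_x (h' \_ (I n)) x)%R = h n.+1%:R - h (- n.+1%:R).
  rewrite -Rintegral_mkcond /Rintegral.
  rewrite (@continuous_FTC2 R h' h)//.
  - by rewrite ltrNl (lt_trans _ (ltr0Sn _ _))// oppr_lt0 ltr0Sn.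
  - exact: continuous_subspaceT.
  - split.
    + by move=> x _; have [] := dh x.
    + by apply: cvg_at_right_filter; exact: ch'.
    + by apply: cvg_at_left_filter; exact: ch'.
  - by move=> x _; rewrite derive1E; have [_ ->] := dh x.
have c1 : (\int[mu]_x (h' \_ (I n)) x @[n --> \oo] --> \int[mu]_x h' x)%R.
  apply: (@cvg_Rintegral_dominated _ _ (fun x => `|h' x|)) => //.
  - by move=> n; apply/(measurable_restrictT _ _).1 => //; exact: measurable_funTS.
  - apply: aeW => x /=; apply: cvg_near_cst.
    near=> n; rewrite patchE ifT// inE /I /= in_itv/=.
    have : `|x| <= n.+1%:R.
      near: n; exists (Num.truncn `|x|) => //= n /= hn.
      rewrite (le_trans (ltW (truncnS_gt _)))// ler_nat; exact: hn.
    by rewrite ler_norml.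
  - exact: integrable_norm ih.
  - by move=> n x; rewrite patchE; case: ifPn => // _; rewrite normr0.
have c2 : (\int[mu]_x (h' \_ (I n)) x @[n --> \oo] --> (0:R))%R.
  rewrite (_ : (fun n => _) = (fun n => h n.+1%:R - h (- n.+1%:R))); last first.
    by apply/funext => n; exact: E.
  by rewrite -[X in _ --> X]subr0; exact: cvgB.
exact: (cvg_unique _ c1 c2).
Unshelve. all: by end_near. Qed.

Lemma measurable_cosM (y : R) : measurable_fun setT (fun x : R => cos (y * x)).
Proof.
apply: (@measurableT_comp _ _ _ _ _ _ cos); last exact: measurable_funM.
by apply: continuous_measurable_fun; exact: continuous_cos.
Qed.

Lemma measurable_sinM (y : R) : measurable_fun setT (fun x : R => sin (y * x)).
Proof.
apply: (@measurableT_comp _ _ _ _ _ _ sin); last exact: measurable_funM.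
by apply: continuous_measurable_fun; exact: continuous_sin.
Qed.

(** The full, unnormalized Fourier transform of [gauss a]: its sine part vanishes by parity. *)
Definition gauss_fourier (a x : R) : R :=
  (\int[mu]_xi (gauss a xi * cos (x * xi)))%R.

Let cosM_is_derive (y x : R) :
  is_derive x 1 (fun x => cos (x * y)) (- (y * sin (x * y))).
Proof.
have d1 : is_derive x 1 (fun z : R => z * y) y.
  by apply: is_derive_eq; rewrite /GRing.scale /=; ring.
by apply: is_derive_eq; rewrite /GRing.scale /=; ring.
Qed.

Let sinM_is_derive (y x : R) :
  is_derive x 1 (fun x => sin (y * x)) (y * cos (y * x)).
Proof.
have d1 : is_derive x 1 (fun z : R => y * z) y.
  by apply: is_derive_eq; rewrite /GRing.scale /=; ring.
by apply: is_derive_eq; rewrite /GRing.scale /=; ring.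
Qed.

Let cvg_gauss_nat a : 0 < a -> gauss a n.+1%:R @[n --> \oo] --> (0:R).
Proof.
move=> a0; apply: (@cvg_comp _ _ _ (fun n : nat => a * n.+1%:R ^+ 2)
  (fun x => expR (- x)) _ +oo%R); last exact: cvgr_expR.
apply/cvgryPge => A; near=> n.
rewrite -ler_pdivrMl//.
apply: (@le_trans _ _ n.+1%:R); last first.
  by rewrite expr2 ler_peMr// ler1n.
near: n; exists (Num.truncn `|a^-1 * A|) => //= n /= hn.
apply: (le_trans (ler_norm _)).
by rewrite (le_trans (ltW (truncnS_gt _)))// ler_nat; exact: hn.
Unshelve. all: by end_near. Qed.

Let gauss_sin_is_derive (a y x : R) :
  is_derive x 1 (fun x => gauss a x * sin (y * x))
    (y * (gauss a x * cos (y * x)) - 2 * a * (x * gauss a x * sin (y * x))).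
Proof.
have d1 := gauss_is_derive a x; have d2 := sinM_is_derive y x.
by apply: is_derive_eq; rewrite /GRing.scale /=; ring.
Qed.

(** The derivative of [gauss a xi * sin (x * xi)] in [xi] integrates to zero, and its two terms are
    the two sides up to constants. This turns the derivative of [gauss_fourier a] into a multiple of
    itself. *)
Lemma gauss_fourier_ibp (a x : R) : 0 < a ->
  (\int[mu]_xi (xi * gauss a xi * sin (x * xi)))%R =
  x / (2 * a) * gauss_fourier a x.
Proof.
move=> a0.
have i1 : mu.-integrable setT (fun xi => (gauss a xi * cos (x * xi))%:E).
  apply: (@integrable_gaussM _ _ 1) => //; first exact: measurable_cosM.
  by move=> y; exact: cos_max.
have i2 : mu.-integrable setT (fun xi => (xi * gauss a xi * sin (x * xi))%:E).
  apply: (@integrable_id_gaussM _ _ 1) => //; first exact: measurable_sinM.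
  by move=> y; exact: sin_max.
have : (\int[mu]_xi (x * (gauss a xi * cos (x * xi)) -
    2 * a * (xi * gauss a xi * sin (x * xi))))%R = 0.
  apply: (@Rintegral_is_derive_eq0 (fun xi => gauss a xi * sin (x * xi))).
  - by move=> y; exact: gauss_sin_is_derive.
  - have cg := @continuous_gauss R a.
    have cM : continuous (fun z : R => x * z).
      by move=> z; apply: cvgM; [exact: cvg_cst|exact: cvg_id].
    move=> y; apply: cvgB; apply: cvgM; try exact: cvg_cst.
    + apply: cvgM; first exact: cg.
      by apply: (@continuous_comp _ _ _ (fun z : R => x * z) cos);
        [exact: cM|exact: continuous_cos].
    + apply: cvgM; first by apply: cvgM; [exact: cvg_id|exact: cg].
      by apply: (@continuous_comp _ _ _ (fun z : R => x * z) sin);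
        [exact: cM|exact: continuous_sin].
  - rewrite (_ : _ \o _ = (fun xi => x%:E * (gauss a xi * cos (x * xi))%:E -
      (2 * a)%:E * (xi * gauss a xi * sin (x * xi))%:E)%E)//.
    by apply: integrableB => //; exact: integrableZl.
  - apply/norm_cvg0P.
    apply: (@squeeze_cvgr _ _ _ _ (fun=> 0) (fun n => gauss a n.+1%:R)).
    + apply: nearW => n; rewrite /= normr_ge0/= normrM ger0_norm ?gauss_ge0//.
      by rewrite ler_piMr ?gauss_ge0// sin_max.
    + exact: cvg_cst.
    + exact: cvg_gauss_nat.
  - apply/norm_cvg0P.
    apply: (@squeeze_cvgr _ _ _ _ (fun=> 0) (fun n => gauss a n.+1%:R)).
    + apply: nearW => n; rewrite /= normr_ge0/= normrM ger0_norm ?gauss_ge0//.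
      by rewrite /gauss sqrrN ler_piMr ?expR_ge0// sin_max.
    + exact: cvg_cst.
    + exact: cvg_gauss_nat.
rewrite RintegralB//; last 2 first.
- rewrite (_ : _ \o _ = (fun xi => x%:E * (gauss a xi * cos (x * xi))%:E)%E)//.
  exact: integrableZl.
- rewrite (_ : _ \o _ = (fun xi => (2 * a)%:E *
    (xi * gauss a xi * sin (x * xi))%:E)%E)//.
  exact: integrableZl.
rewrite !RintegralZl// -/(gauss_fourier a x) => /eqP; rewrite subr_eq0 => /eqP E.
by rewrite mulrAC E; field; rewrite gt_eqF.
Qed.

Lemma gauss_fourier_is_derive (a x : R) : 0 < a ->
  is_derive x 1 (gauss_fourier a) (- (x / (2 * a)) * gauss_fourier a x).
Proof.
move=> a0.
pose f (y xi : R) : R := gauss a xi * cos (y * xi).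
(* A majorant of the derivative in [y] that is free of [y], as differentiation under the integral
   demands. *)
pose G (xi : R) : R := `|xi| * gauss a xi.
have df (y xi : R) : is_derive y 1 (fun z => f z xi)
    (- (xi * gauss a xi * sin (y * xi))).
  have d1 := cosM_is_derive xi y.
  by apply: is_derive_eq; rewrite /GRing.scale /=; ring.
have pE (y xi : R) : derive1 (f ^~ xi) y = - (xi * gauss a xi * sin (y * xi)).
  by rewrite derive1E; have [_ ->] := df y xi.
have intf (y : R) : `]x - 1, x + 1[%classic y -> mu.-integrable setT (EFin \o f y).
  move=> _; apply: (@integrable_gaussM _ _ 1) => //; first exact: measurable_cosM.
  by move=> z; exact: cos_max.
have derf (y xi : R) : `]x - 1, x + 1[%classic y -> [set: R] xi ->
    derivable (f ^~ xi) y 1.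
  by move=> _ _; have [] := df y xi.
have G0 (y : R) : 0 <= G y by rewrite mulr_ge0 ?gauss_ge0.
have intG : mu.-integrable setT (EFin \o G).
  have : mu.-integrable setT (fun x => (x * gauss a x * 1)%:E).
    by apply: (@integrable_id_gaussM _ a 1 (cst 1)) => // z; rewrite normr1.
  move/integrable_norm; congr (integrable _ _ _); apply/funext => y /=.
  by rewrite mulr1 normrM (ger0_norm (gauss_ge0 _ _)).
have Gub (y xi : R) : `]x - 1, x + 1[%classic y -> [set: R] xi ->
    `| partial1of2 f y xi | <= G xi.
  move=> _ _; rewrite /partial1of2 pE normrN normrM normrM.
  by rewrite (ger0_norm (gauss_ge0 _ _)) ler_piMr ?G0// sin_max.
have Ix : `]x - 1, x + 1[%classic x.
  by rewrite /= in_itv/= ltrBlDr !ltrDl ltr01.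
have D1 := @derivable_under_integral R _ _ mu f setT measurableT x _ _ Ix
  intf derf G G0 intG Gub.
have D2 := @differentiation_under_integral R _ _ mu f setT measurableT x _ _ Ix
  intf derf G G0 intG Gub.
split; first exact: D1.
rewrite -derive1E [LHS]D2.
under eq_Rintegral do rewrite /partial1of2 pE -mulN1r.
rewrite RintegralZl//; last first.
  apply: (@integrable_id_gaussM _ _ 1) => //; first exact: measurable_sinM.
  by move=> z; exact: sin_max.
by rewrite gauss_fourier_ibp// mulN1r mulNr.
Qed.

Lemma gauss_fourierE (a x : R) : 0 < a ->
  gauss_fourier a x = Num.sqrt pi / Num.sqrt a * gauss (4 * a)^-1 x.
Proof.
move=> a0; set b := (4 * a)^-1.
(* [gauss (- b)] is the inverse of the expected solution, so [u] has zero derivative and is fixed by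
   its value at 0, the Gaussian integral. *)
pose u (y : R) := gauss_fourier a y * gauss (- b) y.
have du (y : R) : is_derive y 1 u 0.
  have d1 := gauss_fourier_is_derive a y a0.
  have d2 := gauss_is_derive (- b) y.
  apply: is_derive_eq; rewrite /GRing.scale /= /b; field.
  by rewrite gt_eqF.
have uc : u x = u 0.
  by apply: (@is_derive_0_is_cst R u).
have g0 : gauss (- b) 0 = 1 by rewrite /gauss expr0n mulr0 oppr0 expR0.
have := uc; rewrite /u g0 mulr1.
have -> : gauss_fourier a 0 = Num.sqrt pi / Num.sqrt a.
  rewrite /gauss_fourier /Rintegral.
  under eq_integral do rewrite mul0r cos0 mulr1.
  by rewrite integral_gauss.
by move=> <-; rewrite -mulrA -gaussD addNr /gauss mul0r oppr0 expR0 mulr1.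
Qed.

End gauss_fourier.
(** * The binomial series of [(1 - x) ^ al] *)

Section binomial_series.
Context {R : realType}.
Variable al : R.
Hypothesis al01 : 0 < al <= 1.

(** The coefficient of x^(k+1) in (1 - x)^al with its sign reversed, that is (-1)^k binom(al, k+1).
    Leaving out the constant term 1 makes all of them nonnegative for al <= 1. *)
Fixpoint powR_coef (k : nat) : R :=
  if k is k'.+1 then powR_coef k' * (k'.+1%:R - al) / k'.+2%:R else al.

Definition powR_taylor (n : nat) (x : R) : R := 1 - \sum_(k < n) powR_coef k * x ^+ k.+1.

Lemma powR_coef_ge0 k : 0 <= powR_coef k.
Proof.
have /andP[a0 a1] := al01.
elim: k => [|k IH] /=; first exact: ltW.
rewrite divr_ge0// mulr_ge0// subr_ge0 (le_trans a1)// ler1n//.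
Qed.

Let powR_coefS k : k.+2%:R * powR_coef k.+1 = powR_coef k * (k.+1%:R - al).
Proof. by rewrite /= mulrC divfK// pnatr_eq0. Qed.

(** By the recurrence, (k+1) [powR_coef k] is nonincreasing in k. It is the factor of x^k in the
    residual of the differential equation below. *)
Let powR_coef_le k : k.+1%:R * powR_coef k <= al.
Proof.
elim: k => [|k IH]; first by rewrite mul1r.
have /andP[a0 a1] := al01.
rewrite powR_coefS (le_trans _ IH)// mulrC ler_wpM2r ?powR_coef_ge0//.
by rewrite lerBlDr lerDl ltW.
Qed.

(** A telescoping closed form whose sign is visible. As the partial sums decrease on [0, 1], it
    yields their nonnegativity there without any limit at the endpoint 1. *)
Lemma powR_taylor1 n : powR_taylor n 1 = n.+1%:R * powR_coef n / al.
Proof.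
have /andP[a0 a1] := al01.
elim: n => [|n IH]; first by rewrite /powR_taylor big_ord0 subr0 mul1r divff// gt_eqF.
have -> : powR_taylor n.+1 1 = powR_taylor n 1 - powR_coef n.
  by rewrite /powR_taylor big_ord_recr/= opprD addrA expr1n mulr1.
by rewrite IH powR_coefS; field; rewrite gt_eqF.
Qed.

Lemma powR_taylor_ge0 n x : 0 <= x <= 1 -> 0 <= powR_taylor n x.
Proof.
move=> /andP[x0 x1]; apply: (@le_trans _ _ (powR_taylor n 1)).
  have /andP[a0 _] := al01.
  by rewrite powR_taylor1 divr_ge0 ?mulr_ge0 ?powR_coef_ge0// ltW.
rewrite /powR_taylor lerD2l lerN2; apply: ler_sum => k _.
by rewrite expr1n mulr1 ler_piMr ?powR_coef_ge0// exprn_ile1.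
Qed.

Let dpowR_taylor (n : nat) (x : R) : R := - \sum_(k < n) powR_coef k * (k.+1%:R * x ^+ k).

Let powR_taylor_is_derive n (x : R) : is_derive x 1 (powR_taylor n) (dpowR_taylor n x).
Proof.
elim: n => [|n IH].
  rewrite (_ : powR_taylor 0 = cst 1); last first.
    by apply/funext => y; rewrite /powR_taylor big_ord0 subr0.
  by rewrite /dpowR_taylor big_ord0 oppr0; exact: is_derive_cst.
rewrite (_ : powR_taylor n.+1 =
  (fun y => powR_taylor n y - powR_coef n * y ^+ n.+1)); last first.
  by apply/funext => y; rewrite /powR_taylor big_ord_recr/= opprD addrA.
rewrite /dpowR_taylor big_ord_recr/= opprD.
have d1 : is_derive x 1 (fun y : R => y ^+ n.+1) (n.+1%:R * x ^+ n).
  have := @is_deriveX R R id n.+1 x 1 1 (is_derive_id _ _).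
  by rewrite exprfctE /GRing.scale /= mulr1.
have d2 : is_derive x 1 (fun y : R => powR_coef n * y ^+ n.+1)
    (powR_coef n * (n.+1%:R * x ^+ n)) by exact: is_deriveZ.
exact: is_deriveB.
Qed.

(* [powR_taylor n] solves the differential equation [(1 - x) y' + al y = 0] of
   [(1 - x) ^ al] up to an error which is exponentially small in [n]. *)
Let powR_taylor_ode n x : (1 - x) * dpowR_taylor n x + al * powR_taylor n x =
  n.+1%:R * powR_coef n * x ^+ n.
Proof.
elim: n => [|n IH].
  by rewrite /dpowR_taylor /powR_taylor !big_ord0 /= expr0; ring.
rewrite powR_coefS.
have -> : dpowR_taylor n.+1 x = dpowR_taylor n x - powR_coef n * (n.+1%:R * x ^+ n).
  by rewrite /dpowR_taylor big_ord_recr/= opprD.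
have -> : powR_taylor n.+1 x = powR_taylor n x - powR_coef n * x ^+ n.+1.
  by rewrite /powR_taylor big_ord_recr/= opprD addrA.
transitivity (n.+1%:R * powR_coef n * x ^+ n -
  (1 - x) * (powR_coef n * (n.+1%:R * x ^+ n))
   - al * (powR_coef n * x ^+ n.+1)); first by rewrite -IH; ring.
by rewrite exprS; ring.
Qed.

(** The quotient [u n] of the partial sum by (1 - y)^al equals 1 at 0, and its derivative contains
    only the residual of the differential equation. The mean value theorem on [0, x] then bounds |u
    n x - 1| by a constant times x^n; it needs 0 < x, so x = 0 is treated apart. *)
Lemma cvg_powR_taylor x : 0 <= x < 1 ->
  powR_taylor n x @[n --> \oo] --> (1 - x) `^ al.
Proof.
move=> /andP[x0 x1].
have /andP[a0 a1] := al01.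
have [->|xn0] := eqVneq x 0.
  rewrite subr0 powR1 (_ : (fun n => _) = fun=> (1:R)); first exact: cvg_cst.
  apply/funext => n; rewrite /powR_taylor big1 ?subr0// => k _.
  by rewrite exprS mul0r mulr0.
have xp : 0 < x by rewrite lt_neqAle eq_sym xn0.
have y0 : 0 < 1 - x by rewrite subr_gt0.
pose u n (y : R) := powR_taylor n y * (1 - y) `^ (- al).
have du n (y : R) : y < 1 ->
    is_derive y 1 (u n) (n.+1%:R * powR_coef n * y ^+ n * (1 - y) `^ (- al - 1)).
  move=> y1.
  have yp : 0 < 1 - y by rewrite subr_gt0.
  have d1 := powR_taylor_is_derive n y.
  have d2 : is_derive y 1 (fun z : R => 1 - z) (-1).
    have := @is_deriveB R R R (cst 1) id y 1 0 1 (is_derive_cst _ _ _)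
      (is_derive_id _ _).
    by rewrite sub0r.
  have d3 : is_derive (1 - y) 1 (fun z : R => z `^ (- al))
      (- al * (1 - y) `^ (- al - 1)) by exact: is_derive1_powR.
  have d4 : is_derive y 1 (fun z : R => (1 - z) `^ (- al))
      (al * (1 - y) `^ (- al - 1)).
    have := @is_derive1_comp R (fun z : R => z `^ (- al)) (fun z : R => 1 - z) y
      _ _ d3 d2.
    by rewrite mulrN1 mulNr opprK.
  apply: is_derive_eq; rewrite /GRing.scale /= -(powR_taylor_ode n y).
  rewrite (_ : (1 - y) `^ (- al) = (1 - y) * (1 - y) `^ (- al - 1)); first ring.
  rewrite -{2}[1 - y]powRr1 ?(ltW yp)// -powRD; last by rewrite (gt_eqF yp) implybT.
  by congr (_ `^ _); ring.
have bnd n : `|u n x - 1| <= al * (1 - x) `^ (- al - 1) * x ^+ n.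
  have D1 (y : R) : y \in `]0, x[ -> is_derive y 1 (u n)
      (n.+1%:R * powR_coef n * y ^+ n * (1 - y) `^ (- al - 1)).
    by rewrite in_itv/= => /andP[_ yx]; apply: du; exact: lt_trans yx x1.
  have D2 : {within `[0, x], continuous (u n)}.
    apply: derivable_within_continuous => y; rewrite in_itv/= => /andP[_ yx].
    by have [] := du n y (le_lt_trans yx x1).
  have [c] := MVT xp D1 D2.
  have u0 : u n 0 = 1.
    rewrite /u subr0 powR1 mulr1 /powR_taylor big1 ?subr0// => k _.
    by rewrite exprS mul0r mulr0.
  rewrite in_itv/= => /andP[c0 cx]; rewrite u0 subr0 => ->.
  rewrite ger0_norm; last first.
    by rewrite !mulr_ge0 ?powR_coef_ge0 ?powR_ge0 ?exprn_ge0 ?(ltW c0).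
  have h1 : c ^+ n <= x ^+ n by rewrite lerXn2r// ?nnegrE ltW.
  have h2 : (1 - c) `^ (- al - 1) <= (1 - x) `^ (- al - 1).
    rewrite -opprD !powRN lef_pV2 ?posrE ?powR_gt0//; last first.
      by rewrite subr_gt0 (lt_trans cx).
    apply: ge0_ler_powR; rewrite ?nnegrE; first by rewrite addr_ge0 ?ltW.
    + exact: ltW.
    + by rewrite subr_ge0 ltW// (lt_trans cx).
    + by rewrite lerD2l lerN2 ltW.
  rewrite -[leRHS]mulr1; apply: ler_pM; last exact: ltW.
  + by rewrite !mulr_ge0 ?powR_coef_ge0 ?powR_ge0 ?exprn_ge0 ?(ltW c0).
  + exact: ltW.
  rewrite -[leRHS]mulrA [in leRHS](mulrC (_ `^ _)) mulrA.
  apply: ler_pM => //; first by rewrite !mulr_ge0 ?powR_coef_ge0 ?exprn_ge0 ?(ltW c0).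
    exact: powR_ge0.
  by apply: ler_pM => //; rewrite ?mulr_ge0 ?powR_coef_ge0 ?exprn_ge0 ?(ltW c0).
have cu : u n x @[n --> \oo] --> (1:R).
  rewrite -[X in _ --> X]addr0; apply/subr_cvg0 => /=; rewrite addr0.
  apply/norm_cvg0P.
  apply: (@squeeze_cvgr _ _ _ _ (fun=> 0)
    (fun n => al * (1 - x) `^ (- al - 1) * x ^+ n)).
  + by apply: nearW => n; rewrite normr_ge0/= bnd.
  + exact: cvg_cst.
  + rewrite -[X in _ --> X](mulr0 (al * (1 - x) `^ (- al - 1))).
    apply: cvgM; first exact: cvg_cst.
    by apply: cvg_expr; rewrite ger0_norm.
rewrite (_ : (fun n => _) = (fun n => u n x * (1 - x) `^ al)); last first.
  apply/funext => n; rewrite /u -mulrA -powRD ?addNr ?powRr0 ?mulr1//.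
  by rewrite (gt_eqF y0) implybT.
by rewrite -[X in _ --> X]mul1r; apply: cvgM => //; exact: cvg_cst.
Qed.

End binomial_series.
(** * Symbols whose damped Fourier transforms are radially decreasing *)

Section radially_decreasing_symbols.
Context {R : realType}.
Local Notation mu := (@lebesgue_measure R).

(** For even [phi] this is 2 pi times the inverse Fourier transform of [gauss d * phi]; the damping
    makes it converge for every bounded measurable [phi]. *)
Definition damped_fourier (d : R) (phi : R -> R) (x : R) : R :=
  (\int[mu]_xi (gauss d xi * (phi xi * cos (x * xi))))%R.

(* The closure properties of this class replace the subordination of stable
   laws to Gaussian ones. *)
Definition unimodal_symbol (phi : R -> R) : Prop :=
  [/\ measurable_fun setT phi, (exists C : R, forall x, `|phi x| <= C) &
      forall d x x' : R, 0 < d -> `|x| <= `|x'| ->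
        damped_fourier d phi x' <= damped_fourier d phi x].

Lemma integrable_damped (d C x : R) (phi : R -> R) : 0 < d ->
  measurable_fun setT phi -> (forall x, `|phi x| <= C) ->
  mu.-integrable setT (fun xi => (gauss d xi * (phi xi * cos (x * xi)))%:E).
Proof.
move=> d0 mphi phiC; apply: (integrable_gaussM d C) => //.
  by apply: measurable_funM => //; exact: measurable_cosM.
by move=> y; rewrite normrM (le_trans _ (phiC y))// ler_piMr// cos_max.
Qed.

Lemma unimodal_symbol1 : unimodal_symbol (cst 1).
Proof.
split; first exact: measurable_cst.
  by exists 1 => x; rewrite normr1.
move=> d x x' d0 xx'; rewrite /damped_fourier.
under eq_Rintegral do rewrite mul1r.
under [in leRHS]eq_Rintegral do rewrite mul1r.
rewrite -!/(gauss_fourier d _) !gauss_fourierE//.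
apply: ler_wpM2l; first by rewrite divr_ge0 ?sqrtr_ge0.
rewrite /gauss ler_expR lerN2; apply: ler_wpM2l.
  by rewrite invr_ge0 mulr_ge0// ltW.
by rewrite -(real_normK (num_real x)) -(real_normK (num_real x')) lerXn2r// nnegrE.
Qed.

Lemma unimodal_symbolZ (c : R) phi : 0 <= c ->
  unimodal_symbol phi -> unimodal_symbol (fun x => c * phi x).
Proof.
move=> c0 [mphi [C phiC] dec]; split; first exact: measurable_funM.
  exists (c * C) => x; rewrite normrM ger0_norm//; exact: ler_wpM2l.
have E (d x : R) : 0 < d ->
    damped_fourier d (fun x => c * phi x) x = c * damped_fourier d phi x.
  move=> d0; rewrite /damped_fourier -RintegralZl//; last exact: (integrable_damped d C).
  by apply: eq_Rintegral => y _; ring.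
by move=> d x x' d0 xx'; rewrite !E//; apply: ler_wpM2l => //; exact: dec.
Qed.

Lemma unimodal_symbolD phi psi :
  unimodal_symbol phi -> unimodal_symbol psi ->
  unimodal_symbol (fun x => phi x + psi x).
Proof.
move=> [m1 [C1 b1] d1] [m2 [C2 b2] d2]; split; first exact: measurable_funD.
  exists (C1 + C2) => x; rewrite (le_trans (ler_normD _ _))// lerD//.
have E (d x : R) : 0 < d -> damped_fourier d (fun x => phi x + psi x) x =
    damped_fourier d phi x + damped_fourier d psi x.
  move=> d0; rewrite /damped_fourier -RintegralD//;
    [|exact: (integrable_damped d C1)|exact: (integrable_damped d C2)].
  by apply: eq_Rintegral => y _; ring.
by move=> d x x' d0 xx'; rewrite !E//; apply: lerD; [exact: d1|exact: d2].
Qed.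

(** Multiplication by [gauss a] only raises the damping from d to d + a; this is why the class asks
    for monotonicity at every d > 0. *)
Lemma unimodal_symbol_gauss (a : R) phi : 0 <= a ->
  unimodal_symbol phi -> unimodal_symbol (fun x => gauss a x * phi x).
Proof.
move=> a0 [mphi [C phiC] dec]; split.
- by apply: measurable_funM => //; exact: measurable_gauss.
- exists C => x; rewrite normrM ger0_norm ?gauss_ge0// (le_trans _ (phiC x))//.
  by rewrite ler_piMl// gauss_le1.
move=> d x x' d0 xx'.
have E y : damped_fourier d (fun x => gauss a x * phi x) y =
    damped_fourier (d + a) phi y.
  by apply: eq_Rintegral => z _; rewrite gaussD; ring.
by rewrite !E; apply: dec => //; rewrite ltr_wpDr.
Qed.

(** Dominated convergence with majorant C [gauss d]. The point 0 is exempted because the binomial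
    series will be evaluated at [gauss b x], which reaches the end 1 of its interval exactly at x =
    0. *)
Lemma unimodal_symbol_lim (phi_ : (R -> R)^nat) (phi : R -> R) (C : R) :
  (forall n, unimodal_symbol (phi_ n)) -> measurable_fun setT phi ->
  (forall n x, `|phi_ n x| <= C) -> (forall x, `|phi x| <= C) ->
  (forall x, x != 0 -> phi_ n x @[n --> \oo] --> phi x) ->
  unimodal_symbol phi.
Proof.
move=> P_ mphi bnd_ bnd cvgphi; split => //; first by exists C.
move=> d x x' d0 xx'.
have L (y : R) : damped_fourier d (phi_ n) y @[n --> \oo] --> damped_fourier d phi y.
  apply: (@cvg_Rintegral_dominated _ _ _ (fun xi => C * gauss d xi)).
  - move=> n; have [mn _ _] := P_ n.
    apply: measurable_funM; first exact: measurable_gauss.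
    by apply: measurable_funM => //; exact: measurable_cosM.
  - apply: measurable_funM; first exact: measurable_gauss.
    by apply: measurable_funM => //; exact: measurable_cosM.
  - exists [set 0]; split => //; first exact: lebesgue_measure_set1.
    move=> z /= nz; apply: contrapT => z0; apply: nz.
    apply: cvgM; first exact: cvg_cst.
    apply: cvgM; last exact: cvg_cst.
    by apply: cvgphi; apply/eqP.
  - rewrite (_ : _ \o _ = fun xi => (C%:E * (gauss d xi)%:E)%E)//.
    by apply: integrableZl => //; exact: integrable_gauss.
  - move=> n z; rewrite normrM ger0_norm ?gauss_ge0// mulrC.
    apply: ler_wpM2r; first exact: gauss_ge0.
    by rewrite normrM (le_trans _ (bnd_ n z))// ler_piMr// cos_max.
apply: (ler_cvg_to (L x') (L x)).
by apply: nearW => n; have [_ _] := P_ n; exact.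
Qed.

(** Each term of the exponential series arises from the previous one by a Gaussian factor and a
    nonnegative scalar, so the partial sums stay in the class; they are bounded by exp(w)
    uniformly. *)
Lemma unimodal_symbol_exp_gauss (w a : R) phi : 0 <= w -> 0 <= a ->
  unimodal_symbol phi -> unimodal_symbol (fun x => expR (w * gauss a x) * phi x).
Proof.
move=> w0 a0 Pphi; have [mphi [C phiC] _] := Pphi.
have C0 : 0 <= C := le_trans (normr_ge0 _) (phiC 0).
have nd n x : 0 <= exp_coeff (w * gauss a x) n.
  by rewrite exp_coeff_ge0// mulr_ge0// gauss_ge0.
have Pk k : unimodal_symbol (fun x => exp_coeff (w * gauss a x) k * phi x).
  rewrite /exp_coeff; elim: k => [|k IH].
    rewrite (_ : (fun _ => _) = phi)//; apply/funext => x.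
    by rewrite /= expr0 fact0 divr1 mul1r.
  have := unimodal_symbolZ (w / k.+1%:R) _ _ (unimodal_symbol_gauss a _ a0 IH).
  rewrite divr_ge0// => /(_ isT); congr unimodal_symbol; apply/funext => x.
  rewrite /= exprS factS natrM; field.
  by rewrite !pnatr_eq0 -lt0n fact_gt0 addrC natr1 pnatr_eq0.
pose phi_ n x := series (exp_coeff (w * gauss a x)) n * phi x.
have le n x : series (exp_coeff (w * gauss a x)) n <= expR (w * gauss a x).
  apply: nondecreasing_cvgn_le; last exact: is_cvg_series_exp_coeff.
  by apply: nondecreasing_series => k _ _; exact: nd.
have le2 x : expR (w * gauss a x) <= expR w.
  by rewrite ler_expR ler_piMr// gauss_le1.
apply: (@unimodal_symbol_lim phi_ _ (expR w * C)).
- rewrite /phi_ /series /=; elim=> [|n IH].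
    rewrite (_ : (fun x => _) = fun x => 0 * phi x); last first.
      by apply/funext => x; rewrite big_geq.
    exact: unimodal_symbolZ.
  rewrite (_ : (fun x => _) = fun x =>
    (\sum_(0 <= k < n) exp_coeff (w * gauss a x) k) * phi x +
    exp_coeff (w * gauss a x) n * phi x); last first.
    by apply/funext => x; rewrite big_nat_recr//= mulrDl.
  exact: unimodal_symbolD.
- apply: measurable_funM => //; apply: measurableT_comp => //.
  by apply: measurable_funM => //; exact: measurable_gauss.
- move=> n x; rewrite /phi_ normrM; apply: ler_pM => //.
  rewrite ger0_norm; first exact: le_trans (le n x) (le2 x).
  by apply: sumr_ge0 => k _; exact: nd.
- move=> x; rewrite normrM; apply: ler_pM => //.
  by rewrite ger0_norm ?expR_ge0// le2.
- move=> x _; apply: cvgM; last exact: cvg_cst.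
  exact: is_cvg_series_exp_coeff.
Qed.

Lemma unimodal_symbol_exp_sum_gauss (w a : nat -> R) n :
  (forall k, 0 <= w k) -> (forall k, 0 <= a k) ->
  unimodal_symbol (fun x => expR (\sum_(k < n) w k * gauss (a k) x)).
Proof.
move=> w0 a0; elim: n => [|n IH].
  rewrite (_ : (fun x => _) = cst 1); first exact: unimodal_symbol1.
  by apply/funext => x; rewrite big_ord0 expR0.
rewrite (_ : (fun x => _) = fun x => expR (w n * gauss (a n) x) *
  expR (\sum_(k < n) w k * gauss (a k) x)); last first.
  by apply/funext => x; rewrite big_ord_recr/= addrC expRD.
exact: unimodal_symbol_exp_gauss.
Qed.

Lemma gaussX (a x : R) n : gauss (n%:R * a) x = gauss a x ^+ n.
Proof. by rewrite /gauss -expRM_natl; congr expR; ring. Qed.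

Lemma unimodal_symbol_exp_powR_gauss (al b c : R) : 0 < al <= 1 -> 0 < b ->
  0 <= c -> unimodal_symbol (fun x => expR (- (c * (1 - gauss b x) `^ al))).
Proof.
move=> al01 b0 c0.
have g01 x : 0 <= gauss b x <= 1 by rewrite gauss_ge0 gauss_le1// ltW.
apply: (@unimodal_symbol_lim
  (fun n x => expR (- (c * powR_taylor al n (gauss b x))))
  (fun x => expR (- (c * (1 - gauss b x) `^ al))) 1).
- move=> n.
  (* The sign of the binomial coefficients is decisive here: apart from the factor exp(-c), the
     exponent is a nonnegative combination of powers of a Gaussian, which are again Gaussians. *)
  rewrite (_ : (fun x => _) = fun x => expR (- c) *
    expR (\sum_(k < n) (c * powR_coef al k) * gauss (k.+1%:R * b) x)); last first.
    apply/funext => x; rewrite -expRD; congr expR.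
    under eq_bigr do rewrite gaussX -mulrA.
    by rewrite -mulr_sumr /powR_taylor; ring.
  apply: unimodal_symbolZ; first exact: expR_ge0.
  apply: (@unimodal_symbol_exp_sum_gauss (fun k => c * powR_coef al k)
    (fun k => k.+1%:R * b)) => k.
    by rewrite mulr_ge0// powR_coef_ge0.
  by rewrite mulr_ge0// ltW.
- apply: measurableT_comp => //; apply: measurableT_comp => //.
  apply: measurable_funM => //.
  apply: (@measurableT_comp _ _ _ _ _ _ (fun z => z `^ al)).
    exact: measurable_powR.
  by apply: measurable_funB => //; exact: measurable_gauss.
- move=> n x; rewrite ger0_norm ?expR_ge0// -expR0 ler_expR lerNl oppr0.
  by rewrite mulr_ge0// powR_taylor_ge0.
- move=> x; rewrite ger0_norm ?expR_ge0// -expR0 ler_expR lerNl oppr0.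
  by rewrite mulr_ge0// powR_ge0.
- move=> x x0; apply: continuous_cvg; first exact: continuous_expR.
  apply: cvgN; apply: cvgM; first exact: cvg_cst.
  apply: cvg_powR_taylor => //; rewrite gauss_ge0/= /gauss -expR0 ltr_expR.
  by rewrite oppr_lt0 mulr_gt0// exprn_even_gt0.
Qed.

Lemma unimodal_symbol_stable (s : R) : 0 < s -> s < 2 ->
  unimodal_symbol (fun x => expR (- (`|x| `^ s))).
Proof.
(* |x|^s is the power [al] of x^2, and s < 2 puts [al] in the range where the binomial coefficients
   have one sign. *)
move=> s0 s2; pose al := s / 2.
have al01 : 0 < al <= 1 by rewrite /al; apply/andP; split; lra.
have /andP[a0 a1] := al01.
apply: (@unimodal_symbol_lim (fun n x =>
  expR (- (n.+1%:R `^ al * (1 - gauss (n.+1%:R)^-1 x) `^ al)))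
  (fun x => expR (- (`|x| `^ s))) 1).
- by move=> n; apply: unimodal_symbol_exp_powR_gauss.
- apply: measurableT_comp => //; apply: measurableT_comp => //.
  apply: (@measurableT_comp _ _ _ _ _ _ (fun z => z `^ s)).
    exact: measurable_powR.
  exact: normr_measurable.
- move=> n x; rewrite ger0_norm ?expR_ge0// -expR0 ler_expR lerNl oppr0.
  by rewrite mulr_ge0// powR_ge0.
- by move=> x; rewrite [leLHS]ger0_norm ?expR_ge0// -expR0 ler_expR lerNl oppr0.
- move=> x x0; apply: continuous_cvg; first exact: continuous_expR.
  apply: cvgN.
  have t0 : 0 < x ^+ 2 by rewrite exprn_even_gt0.
  have -> : `|x| `^ s = (x ^+ 2) `^ al.
    rewrite -(real_normK (num_real x)) -powR_mulrn// -powRrM.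
    by congr (_ `^ _); rewrite /al mulrC divfK.
  pose v n : R := n.+1%:R * (1 - gauss (n.+1%:R)^-1 x).
  have g1 n : 0 <= 1 - gauss (n.+1%:R)^-1 x.
    by rewrite subr_ge0 gauss_le1// invr_ge0.
  rewrite (_ : (fun n => _) = (fun n => v n `^ al)); last first.
    by apply/funext => n; rewrite /v powRM.
  apply: (@cvg_comp _ _ _ v (fun z : R => z `^ al) _ (nbhs (x ^+ 2))); last first.
    apply: (@differentiable_continuous _ _ _ _ (fun z : R => z `^ al)).
    by apply/derivable1_diffP; have [] := is_derive1_powR al t0.
  (* With y = x^2 / (n+1), the inequality 1 + z <= exp z at z = y and z = -y gives y / (1 + y) <= 1
     - exp (-y) <= y. *)
  apply: (@squeeze_cvgr _ _ _ _
    (fun n => x ^+ 2 * (1 + n.+1%:R^-1 * x ^+ 2)^-1) (fun=> x ^+ 2)).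
  + apply: nearW => n; rewrite /v /gauss.
    have n0 : 0 < n.+1%:R^-1 :> R by rewrite invr_gt0.
    set y := n.+1%:R^-1 * x ^+ 2.
    have y0 : 0 < y by rewrite mulr_gt0.
    have -> : x ^+ 2 = n.+1%:R * y by rewrite /y mulrA divff ?mul1r// pnatr_eq0.
    rewrite -mulrA !ler_pM2l// expRN; apply/andP; split; last first.
      rewrite lerBlDr -lerBlDl -expRN; exact: expR_ge1Dx.
    have h := expR_ge1Dx y.
    have e0 : (expR y)^-1 <= (1 + y)^-1 by rewrite lef_pV2// posrE ?expR_gt0 ?addr_gt0.
    rewrite (_ : y / (1 + y) = 1 - (1 + y)^-1); first by rewrite lerD2l lerN2.
    by field; rewrite gt_eqF// addr_gt0.
  + rewrite -[X in _ --> X]mulr1; apply: cvgM; first exact: cvg_cst.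
    rewrite -[X in _ --> X]invr1; apply: cvgV; first exact: oner_neq0.
    rewrite -[X in _ --> X]addr0; apply: cvgD; first exact: cvg_cst.
    rewrite -[X in _ --> X](mul0r (x ^+ 2)); apply: cvgM; last exact: cvg_cst.
    exact: cvg_harmonic.
  + exact: cvg_cst.
Qed.

End radially_decreasing_symbols.
(** * Gaussian regularizations of a stable density *)

Section smoothed_density.
Context {R : realType}.
Local Notation mu := (@lebesgue_measure R).
Variables (s : R) (p : R -> R).
Hypothesis s02 : 0 < s < 2.
Hypothesis Hp : is_stable_density s p.

Let p0 x : 0 <= p x. Proof. by case: Hp. Qed.
Let mp : measurable_fun setT p. Proof. by case: Hp. Qed.
Let p1 : (\int[mu]_x (p x)%:E = 1)%E. Proof. by case: Hp. Qed.

Lemma integrable_stable_density : mu.-integrable setT (EFin \o p).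
Proof.
apply/integrableP; split; first by apply/measurable_EFinP; exact: mp.
under eq_integral do rewrite gee0_abs ?lee_fin//.
by rewrite p1 ltry.
Qed.

Let integrable_pM (g : R -> R) : measurable_fun setT g ->
  (forall x, `|g x| <= 1) -> mu.-integrable setT (fun x => (p x * g x)%:E).
Proof.
move=> mg g1; apply: (@le_integrable _ _ R mu setT measurableT _ (EFin \o p)).
- by apply/measurable_EFinP; exact: measurable_funM.
- move=> x _; rewrite /= lee_fin normrM (ger0_norm (p0 x)).
  by rewrite ler_piMr.
- exact: integrable_stable_density.
Qed.

(** 2 pi times the convolution of [p] with the centred Gaussian of variance 2 d, written on the
    frequency side so that monotonicity is inherited from the symbol. *)
Definition smoothed_density (d x : R) : R :=
  damped_fourier d (fun xi => expR (- (`|xi| `^ s))) x.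

Lemma smoothed_density_decr (d x x' : R) : 0 < d -> `|x| <= `|x'| ->
  smoothed_density d x' <= smoothed_density d x.
Proof.
have /andP[s0 s2] := s02.
by have [_ _] := unimodal_symbol_stable s s0 s2; exact.
Qed.

(** Fubini for p(t) [gauss d xi] cos((x - t) xi), which is dominated by the integrable product p(t)
    [gauss d xi]: integrating first in [xi] gives the right side, first in [t] the left side. *)
Lemma smoothed_densityE (d x : R) : 0 < d ->
  ((smoothed_density d x)%:E =
   \int[mu]_t (p t * gauss_fourier d (x - t))%:E)%E.
Proof.
move=> d0.
pose f (z : measurableTypeR R * measurableTypeR R) : \bar R :=
  (p z.1 * (gauss d z.2 * cos ((x - z.1) * z.2)))%:E.
have mf : measurable_fun setT f.
  apply/measurable_EFinP; apply: measurable_funM.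
    by apply: measurableT_comp; [exact: mp|exact: measurable_fst].
  apply: measurable_funM.
    by apply: measurableT_comp; [exact: measurable_gauss|exact: measurable_snd].
  apply: (@measurableT_comp _ _ _ _ _ _ (@cos R)).
    by apply: continuous_measurable_fun; exact: continuous_cos.
  apply: measurable_funM; last exact: measurable_snd.
  by apply: measurable_funB; [exact: measurable_cst|exact: measurable_fst].
have cb (t : R) : mu.-integrable setT
    (fun xi => (gauss d xi * cos ((x - t) * xi))%:E).
  apply: (integrable_gaussM d 1) => //; first exact: measurable_cosM.
  by move=> y; exact: cos_max.
have intf : (mu \x mu)%E.-integrable setT f.
  apply/integrable12ltyP => //.
  apply: (@le_lt_trans _ _ (\int[mu]_t ((Num.sqrt pi / Num.sqrt d)%:E * (p t)%:E)%E)%E).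
    apply: ge0_le_integral => //.
    - by move=> t _; exact: integral_ge0.
    - apply: (measurable_fun_fubini_tonelli_F (m2 := mu) (abse \o f)) => //=.
      exact: measurableT_comp.
    - by apply/measurable_EFinP; apply: measurable_funM; [exact: measurable_cst|exact: mp].
    - move=> t _; rewrite /f /=.
      apply: (@le_trans _ _ (\int[mu]_xi ((p t)%:E * (gauss d xi)%:E))%E).
        apply: ge0_le_integral => //.
        + apply/measurable_EFinP; apply: measurableT_comp => //.
          apply: measurable_funM; first exact: measurable_cst.
          apply: measurable_funM; first exact: measurable_gauss.
          exact: measurable_cosM.
        + apply/measurable_EFinP; apply: measurable_funM; first exact: measurable_cst.
          exact: measurable_gauss.
        + move=> xi _; rewrite -EFinM lee_fin normrM (ger0_norm (p0 t)).
          rewrite normrM (ger0_norm (gauss_ge0 _ _)) ler_wpM2l// ler_piMr ?gauss_ge0//.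
          exact: cos_max.
      rewrite ge0_integralZl//.
      + by rewrite integral_gauss// muleC.
      + by apply/measurable_EFinP; exact: measurable_gauss.
      + by move=> xi _; rewrite lee_fin gauss_ge0.
      + by rewrite lee_fin.
  rewrite ge0_integralZl//.
  + by rewrite p1 mule1 ltry.
  + by apply/measurable_EFinP; exact: mp.
  + by move=> t _; rewrite lee_fin.
have := @Fubini _ _ _ _ R mu mu f intf; rewrite /f /=.
under eq_integral => t _.
  under eq_integral do rewrite EFinM.
  rewrite integralZl//.
  rewrite (_ : (\int[mu]_xi _)%E = (gauss_fourier d (x - t))%:E); last first.
    rewrite /gauss_fourier /Rintegral fineK//; exact: integrable_fin_num.
  over.
move=> E; under [RHS]eq_integral do rewrite EFinM.
rewrite E /smoothed_density /damped_fourier /Rintegral fineK; last first.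
  apply: integrable_fin_num => //; apply: (integrable_damped d 1) => //.
    have /andP[s0 s2] := s02.
    by have [] := unimodal_symbol_stable s s0 s2.
  by move=> y; rewrite [leLHS]ger0_norm ?expR_ge0// -expR0 ler_expR lerNl oppr0.
apply: eq_integral => xi _.
have [_ _ _ /(_ xi) [hc hs]] := Hp.
have mc : measurable_fun setT (fun t : R => cos (t * xi)).
  by under eq_fun do rewrite mulrC; exact: measurable_cosM.
have ms : measurable_fun setT (fun t : R => sin (t * xi)).
  by under eq_fun do rewrite mulrC; exact: measurable_sinM.
have ic := integrable_pM _ mc (fun t => cos_max _).
have is_ := integrable_pM _ ms (fun t => sin_max _).
(* The subtraction formula for the cosine separates x from t; the two parts of the Fourier
   hypothesis evaluate the cosine term and cancel the sine term. *)
transitivity (\int[mu]_t ((gauss d xi * cos (x * xi))%:E * (p t * cos (t * xi))%:E +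
  (gauss d xi * sin (x * xi))%:E * (p t * sin (t * xi))%:E))%E.
  rewrite integralD//; [|exact: integrableZl|exact: integrableZl].
  rewrite !integralZl// hc hs mule0 adde0 -EFinM; congr EFin; ring.
apply: eq_integral => t _; rewrite -!EFinM -EFinD; congr EFin.
by rewrite mulrBl cosB; ring.
Qed.

Lemma gauss_fourier_ge0 (d x : R) : 0 < d -> 0 <= gauss_fourier d x.
Proof. by move=> d0; rewrite gauss_fourierE// mulr_ge0 ?gauss_ge0// divr_ge0 ?sqrtr_ge0. Qed.

Lemma measurable_gauss_fourier (d : R) : 0 < d ->
  measurable_fun setT (gauss_fourier d).
Proof.
move=> d0; rewrite (_ : gauss_fourier d = (fun x =>
  Num.sqrt pi / Num.sqrt d * gauss (4 * d)^-1 x)); last first.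
  by apply/funext => x; rewrite gauss_fourierE.
by apply: measurable_funM => //; exact: measurable_gauss.
Qed.

Lemma smoothed_density_ge0 (d x : R) : 0 < d -> 0 <= smoothed_density d x.
Proof.
move=> d0; rewrite -lee_fin smoothed_densityE//; apply: integral_ge0 => t _.
by rewrite lee_fin mulr_ge0// gauss_fourier_ge0.
Qed.

Let mconv (d : R) : 0 < d ->
  measurable_fun setT (fun z : measurableTypeR R * measurableTypeR R =>
    (p z.2 * gauss_fourier d (z.1 - z.2))%:E).
Proof.
move=> d0; apply/measurable_EFinP; apply: measurable_funM.
  by apply: measurableT_comp; [exact: mp|exact: measurable_snd].
apply: measurableT_comp; first exact: measurable_gauss_fourier.
by apply: measurable_funB; [exact: measurable_fst|exact: measurable_snd].
Qed.

Lemma measurable_smoothed_density (d : R) : 0 < d ->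
  measurable_fun setT (smoothed_density d).
Proof.
move=> d0; apply/measurable_EFinP.
rewrite (_ : _ \o _ = fun x =>
  \int[mu]_t (p t * gauss_fourier d (x - t))%:E)%E; last first.
  by apply/funext => x /=; rewrite smoothed_densityE.
apply: (measurable_fun_fubini_tonelli_F (m2 := mu) _ (mconv d d0)) => z.
by rewrite lee_fin mulr_ge0// gauss_fourier_ge0.
Qed.

(** By Tonelli the mass of [p], which is 1, multiplies the mass of a translate of [gauss_fourier d],
    namely (sqrt pi / sqrt d) (sqrt pi sqrt (4 d)) = 2 pi. *)
Lemma integral_smoothed_density (d : R) : 0 < d ->
  (\int[mu]_x (smoothed_density d x)%:E = (2 * pi)%:E)%E.
Proof.
move=> d0; under eq_integral do rewrite smoothed_densityE//.
rewrite (fubini_tonelli _ (mconv d d0)) /=; last first.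
  by move=> z; rewrite lee_fin mulr_ge0// gauss_fourier_ge0.
have mshift (t : R) : measurable_fun setT (fun x : R => gauss_fourier d (x - t)).
  apply: measurableT_comp; first exact: measurable_gauss_fourier.
  exact: measurable_funB.
have E (t : R) : (\int[mu]_x (gauss_fourier d (x - t))%:E = (2 * pi)%:E)%E.
  have := @ge0_integral_affine R 1 (- t) (EFin \o gauss_fourier d).
  rewrite oner_neq0 normr1 mul1e => /(_ isT) H.
  transitivity (\int[mu]_x (EFin \o gauss_fourier d) (1 * x - t)%R)%E.
    by apply: eq_integral => x _; rewrite /= mul1r.
  rewrite -H; last 2 first.
  - by apply/measurable_EFinP; exact: measurable_gauss_fourier.
  - by move=> x; rewrite lee_fin gauss_fourier_ge0.
  under eq_integral do rewrite /= gauss_fourierE// EFinM.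
  rewrite ge0_integralZl//; last 2 first.
  - by apply/measurable_EFinP; exact: measurable_gauss.
  - by move=> x _; rewrite lee_fin gauss_ge0.
  rewrite integral_gauss ?invr_gt0 ?mulr_gt0// -EFinM; congr EFin.
  have sd0 : Num.sqrt d != 0 by rewrite gt_eqF// sqrtr_gt0.
  rewrite sqrtrV ?mulr_ge0// ?(ltW d0)// invrK sqrtrM// (_ : 4 = 2 ^+ 2 :> R); last by ring.
  rewrite sqrtr_sqr ger0_norm// -{3}(sqr_sqrtr (pi_ge0 R)); field.
  exact: sd0.
under eq_integral => t _.
  under eq_integral do rewrite EFinM.
  rewrite ge0_integralZl//; last 3 first.
  - by apply/measurable_EFinP; exact: mshift.
  - by move=> x _; rewrite lee_fin gauss_fourier_ge0.
  - by rewrite lee_fin.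
  rewrite E muleC.
  over.
rewrite ge0_integralZl//.
- by rewrite p1 mule1.
- by apply/measurable_EFinP; exact: mp.
- by move=> t _; rewrite lee_fin.
- by rewrite lee_fin mulr_ge0// pi_ge0.
Qed.

End smoothed_density.
(** * Radially decreasing kernels *)

Section decreasing_kernel.
Context {R : realType}.
Local Notation mu := (@lebesgue_measure R).

Let F (e : R) (k : nat) : set R := ball (0:R) (e * 2 ^+ k).

Let ndF e : 0 < e -> nondecreasing_seq (F e).
Proof.
move=> e0; apply/nondecreasing_seqP => k; apply/subsetPset; apply: le_ball.
by rewrite ler_pM2l// ler_eXn2l// ltr1n.
Qed.

Let mF e k : measurable (F e k). Proof. exact: measurable_ball. Qed.

Let mseqD e k : measurable (seqD (F e) k).
Proof. by case: k => [|k] /=; [exact: mF|apply: measurableD; exact: mF]. Qed.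

Let bigcupF e : 0 < e -> \bigcup_k seqD (F e) k = setT.
Proof.
move=> e0; rewrite eq_bigcup_seqD; apply/seteqP; split => // x _.
pose n := Num.truncn (`|x| / e); exists n => //.
rewrite /F /ball /= sub0r normrN -ltr_pdivrMl// mulrC.
apply: (lt_le_trans (truncnS_gt _)).
by rewrite -natrX ler_nat; exact: ltn_expl.
Qed.

Let integral_dyadic e (f : R -> \bar R) : 0 < e -> measurable_fun setT f ->
  (forall x, 0 <= f x)%E ->
  (\int[mu]_x f x = \sum_(0 <= k <oo) \int[mu]_(x in seqD (F e) k) f x)%E.
Proof.
move=> e0 mf f0; rewrite -[in LHS](bigcupF e e0) ge0_integral_bigcup//.
- by move=> k; exact: mseqD.
- by rewrite bigcupF.
- by apply: trivIset_seqD; exact: ndF.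
Qed.

(* The mass of [K] on a dyadic annulus controls the value of [K] on the next
   one, so the layers of [K] are dominated by multiples of balls of total mass
   comparable to that of [K]. *)
Lemma integral_decreasing_kernel_le (K g : R -> R) (I h : R) :
  (forall x, 0 <= K x) -> measurable_fun setT K ->
  (forall x x', `|x| <= `|x'| -> K x' <= K x) ->
  (\int[mu]_x (K x)%:E <= I%:E)%E ->
  (forall x, 0 <= g x) -> measurable_fun setT g ->
  (forall r : R, 0 < r ->
    (\int[mu]_(x in ball (0%R : R) r) (g x)%:E <= (2 * r * h)%:E)%E) ->
  (\int[mu]_x (K x * g x)%:E <= ((1 + 4 * I) * h)%:E)%E.
Proof.
move=> K0 mK Kdec KI g0 mg gh.
have h0 : 0 <= h.
  have : (0 <= (2 * 1 * h)%:E)%E.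
    by apply: le_trans (gh 1 ltr01); apply: integral_ge0 => x _; rewrite lee_fin.
  by rewrite lee_fin; lra.
(* The two innermost layers have no annulus of their own to be charged to. Together they cost at
   most 2 e K(0) + 4 e K(e) <= 6 e K(0) <= 1, so that K(0), which depends on the smoothing, leaves
   no trace in the bound. *)
pose e : R := (6 * K 0 + 1)^-1.
have e0 : 0 < e by rewrite invr_gt0 ltr_pwDr// mulr_ge0.
have eK : 6 * (e * K 0) <= 1.
  rewrite mulrCA /e mulrC ler_pdivrMr ?mul1r ?lerDl//.
  by rewrite ltr_pwDr// mulr_ge0.
have mK' : measurable_fun setT (EFin \o K) by apply/measurable_EFinP.
have p2 k : 0 < 2 ^+ k :> R by rewrite exprn_gt0.
(* An upper bound of [K] on layer k: its value at the inner radius, or at 0 for the central ball. *)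
pose c k : R := if k is k'.+1 then K (e * 2 ^+ k') else K 0.
have c0 k : 0 <= c k by case: k => [|k]; exact: K0.
have Kc k x : seqD (F e) k x -> K x <= c k.
  case: k => [_|k [_]] /=; first by apply: Kdec; rewrite normr0.
  rewrite /F /ball /= sub0r normrN => /negP; rewrite -leNgt => kx.
  by apply: Kdec; rewrite ger0_norm// mulr_ge0// ltW.
have seqDF k : seqD (F e) k `<=` F e k by case: k => [|k] //= x [].
have mD k : measurable (seqD (F e) k) := mseqD e k.
have mFe k : measurable (F e k) := mF e k.
have h1 k : (\int[mu]_(x in seqD (F e) k) (K x * g x)%:E <=
    (c k * (2 * (e * 2 ^+ k)) * h)%:E)%E.
  apply: (@le_trans _ _ (\int[mu]_(x in seqD (F e) k) ((c k)%:E * (g x)%:E))%E).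
    apply: ge0_le_integral => //.
    - exact: mD.
    - by move=> x _; rewrite lee_fin mulr_ge0.
    - by apply/measurable_EFinP; apply: measurable_funTS; exact: measurable_funM.
    - by apply/measurable_EFinP; apply: measurable_funTS; exact: measurable_funM.
    - by move=> x kx; rewrite -EFinM lee_fin ler_wpM2r// Kc.
  rewrite ge0_integralZl//; last 4 first.
  - exact: mD.
  - by apply/measurable_EFinP; exact: measurable_funTS.
  - by move=> x _; rewrite lee_fin.
  - by rewrite lee_fin.
  rewrite -mulrA EFinM; apply: lee_wpmul2l; first by rewrite lee_fin.
  apply: (le_trans _ (gh _ (mulr_gt0 e0 (p2 k)))).
  apply: ge0_subset_integral => //.
  + exact: mD.
  + exact: mF.
  + by apply/measurable_EFinP; exact: measurable_funTS.
  + by move=> x _; rewrite lee_fin.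
rewrite (integral_dyadic e)//; last 2 first.
- by apply/measurable_EFinP; exact: measurable_funM.
- by move=> x; rewrite lee_fin mulr_ge0.
(* The inner radius of layer k+2 is the outer radius of layer k+1, where [K] is therefore at least
   [c k.+2]. That annulus has measure 2 e 2^k, a quarter of the measure of the ball of radius e
   2^(k+2). *)
have ann k : ((c k.+2 * (2 * (e * 2 ^+ k.+2)))%:E <=
    4%:E * \int[mu]_(x in seqD (F e) k.+1) (K x)%:E)%E.
  have -> : c k.+2 * (2 * (e * 2 ^+ k.+2)) =
      4 * (c k.+2 * (2 * (e * 2 ^+ k))) by rewrite !exprS; ring.
  rewrite EFinM; apply: lee_wpmul2l; first by rewrite lee_fin.
  have -> : ((c k.+2 * (2 * (e * 2 ^+ k)))%:E =
      \int[mu]_(x in seqD (F e) k.+1) (cst (c k.+2)%:E) x)%E.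
    rewrite integral_cst /=; last exact: (mD k.+1).
    rewrite EFinM; congr (_ * _)%E.
    have muFE j : mu (F e j) = (e * 2 ^+ j *+ 2)%:E.
      by rewrite /F lebesgue_measure_ball// mulr_ge0// ltW.
    have muF : (mu (F e k.+1) < +oo)%E by rewrite muFE ltry.
    rewrite (@measureD _ _ _ mu _ _ (mFe k.+1) (mFe k) muF).
    rewrite setIidr; last by apply/subsetPset; exact: ndF.
    transitivity ((e * 2 ^+ k.+1 *+ 2)%:E - (e * 2 ^+ k *+ 2)%:E)%E.
      by rewrite -EFinB exprS; congr EFin; ring.
    by congr (_ - _)%E; exact/esym/muFE.
  apply: ge0_le_integral => //.
  - exact: mD.
  - by move=> x _; rewrite lee_fin.
  - by apply/measurable_EFinP; exact: measurable_funTS.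
  - move=> x [+ _]; rewrite /F /ball /= sub0r normrN => kx.
    have er : 0 <= e * 2 ^+ k.+1 by rewrite mulr_ge0// ltW.
    by rewrite lee_fin Kdec// (ger0_norm er) ltW.
have tot n : \sum_(0 <= k < n) c k * (2 * (e * 2 ^+ k)) <= 1 + 4 * I.
  (* Two extra terms make it possible to split off layers 0 and 1, which account for the 1, and to
     charge all others to annuli. *)
  apply: (@le_trans _ _ (\sum_(0 <= k < n.+2) c k * (2 * (e * 2 ^+ k)))).
    have nn : (n <= n.+2)%N by rewrite ltnW.
    rewrite [leRHS](@big_cat_nat _ _ _ n)//=.
    by rewrite lerDl sumr_ge0// => k _; rewrite !mulr_ge0// ?ltW.
  rewrite big_nat_recl// big_nat_recl//= !expr0 expr1 addrA.
  apply: lerD.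
    have ce : K (e * 1) <= K 0 by apply: Kdec; rewrite normr0.
    have : e * K (e * 1) <= e * K 0 by rewrite ler_pM2l.
    by move: eK; nra.
  rewrite -lee_fin -sumEFin.
  apply: (@le_trans _ _ (\sum_(0 <= k < n)
      4%:E * \int[mu]_(x in seqD (F e) k.+1) (K x)%:E)%E).
    by apply: lee_sum => k _; exact: ann.
  have i0 k : (0 <= \int[mu]_(x in seqD (F e) k) (K x)%:E)%E.
    by apply: integral_ge0 => x _; rewrite lee_fin.
  rewrite -ge0_sume_distrr//.
  rewrite EFinM; apply: lee_wpmul2l; first by rewrite lee_fin.
  apply: le_trans KI.
  rewrite (@integral_dyadic e (fun x => (K x)%:E) e0 mK'); last first.
    by move=> x; rewrite lee_fin.
  apply: (@le_trans _ _ (\sum_(0 <= k < n.+1)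
    \int[mu]_(x in seqD (F e) k) (K x)%:E)%E).
    by rewrite big_nat_recl//= leeDr//; exact: (i0 0%N).
  by apply: nneseries_lim_ge => k _ _; exact: i0.
apply: lime_le.
  apply: is_cvg_nneseries => k _ _; apply: integral_ge0 => x _.
  by rewrite lee_fin mulr_ge0.
apply: nearW => n.
apply: (@le_trans _ _ (\sum_(0 <= k < n) (c k * (2 * (e * 2 ^+ k)) * h)%:E)%E).
  by apply: lee_sum => k _; exact: h1.
by rewrite sumEFin lee_fin -mulr_suml; apply: ler_wpM2r.
Qed.

End decreasing_kernel.
(** * Domination by the Hardy-Littlewood maximal function *)

Lemma le_limn_einf (R : realType) (u v : (\bar R)^nat) :
  (forall n, u n <= v n)%E -> (limn_einf u <= limn_einf v)%E.
Proof.
move=> uv; rewrite !limn_einf_lim; apply: lee_lim; [exact: is_cvg_einfs..|].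
apply: nearW => n; apply: le_ereal_inf_tmp => _ [m /= nm <-].
by apply: le_trans (uv m); apply: ereal_inf_lbound; exists m.
Qed.

Lemma measurable_fun_limn_einf d (T : measurableType d) (R : realType)
    (f : (T -> \bar R)^nat) : (forall n, measurable_fun setT (f n)) ->
  measurable_fun setT (fun x => limn_einf (f ^~ x)).
Proof.
move=> mf; rewrite (_ : (fun x => _) =
  (fun x => - limn_esup ((fun n y => - f n y) ^~ x))%E); last first.
  by apply/funext => x; rewrite (limn_esupN (f ^~ x)) oppeK.
apply: measurableT_comp => //; apply: measurable_fun_limn_esup => n.
exact: measurableT_comp.
Qed.

(** * Stable densities tested against functions with bounded means *)

Section stable_kernel.
Context {R : realType}.
Local Notation mu := (@lebesgue_measure R).

(** At distance at most r from its centre, [gauss_fourier (r ^+ 2)] is at least (sqrt pi / r)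
    exp(-1/4), which is this constant divided by the length 2 r of the ball. *)
Definition peak_const : R := 2 * Num.sqrt pi * expR (- 4^-1).

Lemma peak_const_gt0 : 0 < peak_const.
Proof. by rewrite !mulr_gt0 ?expR_gt0// sqrtr_gt0 pi_gt0. Qed.

(** The factor 1 + 4 I of the kernel estimate at the mass I = 2 pi, divided by the loss in comparing
    means with smoothings. *)
Definition stable_const : R := (1 + 4 * (2 * pi)) / peak_const.

Lemma stable_const_gt0 : 0 < stable_const.
Proof. by rewrite divr_gt0 ?peak_const_gt0// addr_gt0// !mulr_gt0// pi_gt0. Qed.

Let r_ (n : nat) : R := n.+1%:R^-1.

Let r_gt0 n : 0 < r_ n. Proof. by rewrite invr_gt0. Qed.

Let E (x : R) (n : nat) : set R := ball x (r_ n).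

Let hE (x : R) : nicely_shrinking x (E x).
Proof.
split; first by move=> n; exact: measurable_ball.
exists (1, fun n => PosNum (r_gt0 n)); split.
- exact: ltr01.
- exact: cvg_harmonic.
- by move=> n.
- by move=> n; rewrite [leRHS]mul1e.
Qed.

Let gauss_fourier_lower n (x t : R) : E x n t ->
  peak_const / (r_ n *+ 2) <= gauss_fourier (r_ n ^+ 2) (x - t).
Proof.
rewrite /E /ball /= => xt.
have r0 := r_gt0 n.
rewrite gauss_fourierE ?exprn_gt0// sqrtr_sqr gtr0_norm//.
rewrite (_ : peak_const / _ = Num.sqrt pi / r_ n * expR (- 4^-1)); last first.
  by rewrite /peak_const; field; rewrite gt_eqF.
apply: ler_wpM2l; first by rewrite divr_ge0 ?sqrtr_ge0// ltW.
rewrite /gauss ler_expR lerN2 invfM -mulrA ler_piMr ?invr_ge0//.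
rewrite mulrC ler_pdivrMr ?exprn_gt0// mul1r.
by rewrite -(real_normK (num_real (x - t))) lerXn2r ?nnegrE// ltW.
Qed.

Lemma integral_stable_density_le (s : R) (p g : R -> R) (h : R) : 0 < s < 2 ->
  is_stable_density s p -> (forall x, 0 <= g x) -> measurable_fun setT g ->
  (forall r : R, 0 < r ->
    (\int[mu]_(x in ball (0%R : R) r) (g x)%:E <= (2 * r * h)%:E)%E) ->
  (\int[mu]_x (p x * g x)%:E <= (stable_const * h)%:E)%E.
Proof.
move=> s02 Hp g0 mg gh.
have [p0 mp p1 _] := Hp; have k0 := peak_const_gt0.
(* The damping is the square of the radius, which matches the width of the Gaussian to the ball
   [E x n]. *)
pose K n := smoothed_density s (r_ n ^+ 2).
have d0 n : 0 < r_ n ^+ 2 by rewrite exprn_gt0.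
have K0 n x : 0 <= K n x by exact: (smoothed_density_ge0 _ _ s02 Hp).
have mK n : measurable_fun setT (K n).
  exact: (measurable_smoothed_density _ _ s02 Hp).
have Kg n : (\int[mu]_x (K n x * g x)%:E <= ((1 + 4 * (2 * pi)) * h)%:E)%E.
  apply: integral_decreasing_kernel_le => //.
  - by move=> x x' xx'; exact: (smoothed_density_decr _ s02).
  - by rewrite (integral_smoothed_density _ _ s02 Hp).
pose Kg_ n (x : R) : \bar R := (K n x * g x)%:E.
have mKg n : measurable_fun setT (Kg_ n).
  by apply/measurable_EFinP; exact: measurable_funM.
have Kg0 n x : (0 <= Kg_ n x)%E by rewrite lee_fin mulr_ge0.
have mpg : measurable_fun setT (fun x => (peak_const * (p x * g x))%:E).
  apply/measurable_EFinP; apply: measurable_funM => //.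
  exact: measurable_funM.
have locp : locally_integrable setT p.
  by apply: open_integrable_locally; [exact: openT|
    exact: (integrable_stable_density _ _ Hp)].
have le1 : (\int[mu]_x (peak_const * (p x * g x))%:E <=
    \int[mu]_x limn_einf (Kg_ ^~ x))%E.
  apply: ae_ge0_le_integral => //.
  - by move=> x _; rewrite lee_fin mulr_ge0 ?mulr_ge0// ltW.
  - move=> x _; rewrite -(cvg_limn_einf_sup (cvg_cst (0 : \bar R))).1.
    exact: le_limn_einf.
  - exact: measurable_fun_limn_einf.
  apply: (@filterS _ _ (ae_filter_ringOfSetsType mu)) (lebesgue_differentiation locp).
  move=> x /(@nice_lebesgue_differentiation R E hE p locp x) px _.
  (* At a Lebesgue point the means of [p] over [E x n] tend to [p x]. Each mean, multiplied by
     [peak_const], is at most [K n x], since the Gaussian dominates the normalized indicator of the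
     ball. *)
  have cv : ((peak_const * g x)%:E * ((mu (E x n))^-1 *
      \int[mu]_(y in E x n) (p y)%:E) @[n --> \oo] -->
      (peak_const * g x)%:E * (p x)%:E)%E by exact: cvgeZl.
  rewrite [leLHS](_ : _ = (peak_const * g x)%:E * (p x)%:E)%E; last first.
    by rewrite -EFinM; congr EFin; ring.
  rewrite -(cvg_limn_einf_sup cv).1; apply: le_limn_einf => n.
  rewrite /Kg_ /K [leRHS]EFinM (smoothed_densityE _ _ s02 Hp)//.
  rewrite (mulrC peak_const) EFinM -muleA [leRHS]muleC.
  apply: lee_wpmul2l; first by rewrite lee_fin.
  rewrite muleA.
  have -> : (peak_const%:E * (mu (E x n))^-1 = (peak_const / (r_ n *+ 2))%:E)%E.
    rewrite /E lebesgue_measure_ball ?(ltW (r_gt0 n))// inver ifF.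
      by rewrite -EFinM.
    by rewrite gt_eqF// pmulrn_lgt0.
  rewrite -ge0_integralZl//; last 4 first.
  - exact: measurable_ball.
  - by apply/measurable_EFinP; exact: measurable_funTS.
  - by move=> y _; rewrite lee_fin.
  - by rewrite lee_fin divr_ge0 ?(ltW peak_const_gt0)// mulrn_wge0// ltW.
  have mc : measurable_fun setT
      (fun t => (p t * gauss_fourier (r_ n ^+ 2) (x - t))%:E).
    apply/measurable_EFinP; apply: measurable_funM => //.
    apply: measurableT_comp; first exact: measurable_gauss_fourier.
    exact: measurable_funB.
  apply: (@le_trans _ _ (\int[mu]_(t in E x n)
      (p t * gauss_fourier (r_ n ^+ 2) (x - t))%:E)%E).
    apply: ge0_le_integral => //.
    - exact: measurable_ball.
    - move=> t _; rewrite -EFinM lee_fin mulr_ge0// divr_ge0 ?(ltW peak_const_gt0)//.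
      by rewrite mulrn_wge0// ltW.
    - apply/measurable_EFinP; apply: measurable_funM => //.
      exact: measurable_funTS.
    - exact: measurable_funTS mc.
    - move=> t xt; rewrite -EFinM lee_fin mulrC ler_wpM2l//.
      exact: gauss_fourier_lower.
  apply: ge0_subset_integral => //; first exact: measurable_ball.
  by move=> t _; rewrite lee_fin mulr_ge0// gauss_fourier_ge0.
have le2 : (\int[mu]_x (peak_const * (p x * g x))%:E <=
    ((1 + 4 * (2 * pi)) * h)%:E)%E.
  apply: (le_trans le1).
  apply: (le_trans (fatou _ _ _ _)) => //.
  rewrite -(cvg_limn_einf_sup (cvg_cst (((1 + 4 * (2 * pi)) * h)%:E : \bar R))).1.
  exact: le_limn_einf.
move: le2; under eq_integral do rewrite EFinM.
rewrite ge0_integralZl//; last 3 first.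
- by apply/measurable_EFinP; exact: measurable_funM.
- by move=> x _; rewrite lee_fin mulr_ge0.
- by rewrite lee_fin ltW.
rewrite -lee_pdivlMl// -EFinM /stable_const => /le_trans; apply.
by rewrite lee_fin mulrAC mulrC.
Qed.

End stable_kernel.

(** * Translation and dilation of the kernel estimate *)

Section maximal_domination.
Context {R : realType}.
Local Notation mu := (@lebesgue_measure R).

Lemma HL_maximal_ge0T (f : R -> R) (x : R) : (0 <= HL_maximal f x)%E.
Proof.
apply: (@le_trans _ _ (iavg f (ball x 1))); first exact: iavg_ge0.
by apply: ereal_sup_ubound; exists 1 => //; rewrite /= in_itv/= andbT ltr01.
Qed.

Lemma integral_ball_le_HL (f : R -> R) (x r h : R) : 0 < r ->
  HL_maximal f x = h%:E ->
  (\int[mu]_(t in ball x r) `|f t|%:E <= (2 * r * h)%:E)%E.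
Proof.
move=> r0 Hh.
have : (iavg f (ball x r) <= h%:E)%E.
  by rewrite -Hh; apply: ereal_sup_ubound; exists r => //; rewrite /= in_itv/= andbT.
rewrite /iavg lebesgue_measure_ball ?(ltW r0)//.
have r2 : 0 < r *+ 2 by rewrite pmulrn_lgt0.
rewrite inver gt_eqF// lee_pdivrMl// => /le_trans; apply.
by rewrite -EFinM lee_fin mulr_natl.
Qed.

Lemma abse_stable_conv_le (L : R -> R -> R) (s y x : R) (f : R -> R) :
  0 < s < 2 -> is_stable_density s (L s) -> 0 < y -> measurable_fun setT f ->
  (`|stable_conv L s y f x| <= stable_const%:E * HL_maximal f x)%E.
Proof.
move=> s02 Hp y0 mf; have [p0 mp _ _] := Hp.
have mxt : measurable_fun setT (fun t : R => L s ((x - t) / y)).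
  apply: measurableT_comp; first exact: mp.
  by apply: measurable_funM => //; exact: measurable_funB.
(* An infinite maximal function makes the bound trivial, as [stable_const] is positive; otherwise
   its value is a real [h], as the kernel estimate requires. *)
have [HLy|HLf] := eqVneq (HL_maximal f x) +oo%E.
  by rewrite HLy gt0_muley ?leey// lte_fin stable_const_gt0.
have [h Hh] : exists h, HL_maximal f x = h%:E.
  exists (fine (HL_maximal f x)); rewrite fineK// fin_numElt.
  by rewrite (lt_le_trans _ (HL_maximal_ge0T f x))//= lt_neqAle HLf leey.
rewrite Hh -EFinM.
have myf : measurable_fun setT (fun u : R => f (- y * u + x)).
  by apply: measurableT_comp; [exact: mf|exact: measurable_affine].
apply: (@le_trans _ _ (\int[mu]_t (y^-1 * L s ((x - t) / y) * `|f t|)%:E)%E).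
  apply: (le_trans (le_abse_integral mu measurableT _)).
    apply/measurable_EFinP; apply: measurable_funM => //.
    exact: measurable_funM.
  apply: ge0_le_integral => //.
  - apply/measurable_EFinP; apply: measurableT_comp => //.
    by apply: measurable_funM => //; exact: measurable_funM.
  - apply/measurable_EFinP; apply: measurable_funM.
      exact: measurable_funM.
    exact: measurableT_comp.
  - move=> t _; rewrite /= lee_fin normrM ger0_norm// mulr_ge0//.
    by rewrite invr_ge0 ltW.
have ny : - y != 0 by rewrite oppr_eq0 gt_eqF.
(* Substituting t = x - y u cancels the factor 1/y and turns the argument of the density into u. *)
have E1 := @ge0_integral_affine R (- y) x
  (fun t => (y^-1 * L s ((x - t) / y) * `|f t|)%:E) ny.
rewrite E1; last 2 first.
- apply/measurable_EFinP; apply: measurable_funM.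
    exact: measurable_funM.
  exact: measurableT_comp.
- by move=> t; rewrite lee_fin !mulr_ge0// invr_ge0 ltW.
rewrite normrN gtr0_norm// -ge0_integralZl//; last 3 first.
- apply/measurable_EFinP; apply: measurable_funM; last exact: measurableT_comp.
  apply: measurable_funM => //; apply: measurableT_comp; first exact: mp.
  apply: measurable_funM => //; apply: measurable_funB => //.
  exact: measurable_affine.
- by move=> u _; rewrite lee_fin !mulr_ge0// invr_ge0 ltW.
- by rewrite lee_fin ltW.
rewrite [leLHS](_ : _ = \int[mu]_u (L s u * `|f (- y * u + x)|)%:E)%E; last first.
  apply: eq_integral => u _; rewrite -EFinM; congr EFin.
  rewrite (_ : (x - (- y * u + x)) / y = u); last by field; rewrite gt_eqF.
  by rewrite mulrA mulrA divff ?mul1r// gt_eqF.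
apply: (@integral_stable_density_le R s) => //; first exact: measurableT_comp.
move=> r r0.
(* The same substitution carries the ball of radius r about 0 to the ball of radius y r about x, so
   means of the rescaled function are means of |f| around x, still at most [h]. *)
pose F (t : R) : \bar R := (`|f t| * \1_(ball x (y * r)) t)%:E.
have mF : measurable_fun setT F.
  apply/measurable_EFinP; apply: measurable_funM; first exact: measurableT_comp.
  apply: measurable_indic; exact: measurable_ball.
have E2 := @ge0_integral_affine R (- y) x F ny mF.
have FE : (\int[mu]_t F t <= (2 * (y * r) * h)%:E)%E.
  apply: le_trans (integral_ball_le_HL f x (y * r) h (mulr_gt0 y0 r0) Hh).
  rewrite [leRHS]integral_mkcond; under [leRHS]eq_integral do rewrite patchE.
  rewrite le_eqVlt; apply/orP; left; apply/eqP; apply: eq_integral => t _.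
  by rewrite /F indicE; case: ifPn => _; rewrite ?mulr1 ?mulr0.
have GE : (\int[mu]_(u in ball (0%R : R) r) `|f (- y * u + x)%R|%:E =
    \int[mu]_u F (- y * u + x)%R)%E.
  rewrite integral_mkcond; apply: eq_integral => u _.
  rewrite patchE /F indicE.
  have -> : (- y * u + x \in (ball x (y * r) : set R)) = (u \in (ball (0:R) r : set R)).
    apply/idP/idP; rewrite !inE /ball /=.
      by rewrite (_ : x - (- y * u + x) = y * u); [|ring];
        rewrite sub0r normrN normrM gtr0_norm// ltr_pM2l.
    by rewrite (_ : x - (- y * u + x) = y * u); [|ring];
      rewrite sub0r normrN normrM gtr0_norm// ltr_pM2l.
  by case: ifPn => _; rewrite ?mulr1 ?mulr0.
move: FE; rewrite E2; last by move=> t; rewrite lee_fin mulr_ge0// indicE.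
rewrite GE normrN gtr0_norm// -lee_pdivlMl// => /le_trans; apply.
rewrite -EFinM lee_fin le_eqVlt; apply/orP; left; apply/eqP.
by field; rewrite gt_eqF.
Qed.

Lemma Lstar_le_HL_maximal (L : R -> R -> R)
    (HL : forall s : R, 0 < s -> s < 2 -> is_stable_density s (L s))
    (f : R -> R) (x : R) : measurable_fun setT f ->
  (Lstar L f x <= stable_const%:E * HL_maximal f x)%E.
Proof.
move=> mf; apply: ge_ereal_sup => _ [y [s [y0 s0 s2 ->]]].
by apply: abse_stable_conv_le => //; [rewrite s0|exact: HL].
Qed.

Lemma Lstar_ge0 (L : R -> R -> R) (f : R -> R) (x : R) : (0 <= Lstar L f x)%E.
Proof.
(* One admissible pair is needed because an empty supremum would be -oo. *)
apply: (@le_trans _ _ `|stable_conv L 1 1 f x|%E); first exact: abse_ge0.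
apply: ereal_sup_ubound; exists 1, 1; split => //.
by rewrite ltr1n.
Qed.

End maximal_domination.
(** * Strong type of the Hardy-Littlewood maximal operator *)

(** The integral of a nonnegative function is a supremum over the simple functions below it. In this
    form monotonicity applies to [Lstar L f], an uncountable supremum. *)
Lemma ge0_le_integral_nonmeasurable d (T : measurableType d) (R : realType)
    (mu : {measure set T -> \bar R}) (f g : T -> \bar R) :
  (forall x, 0 <= f x)%E -> (forall x, f x <= g x)%E ->
  (\int[mu]_x f x <= \int[mu]_x g x)%E.
Proof.
move=> f0 fg; have g0 x : (0 <= g x)%E by exact: le_trans (fg x).
rewrite !ge0_integralTE//; apply: le_ereal_sup => _ [h /= hf <-].
by exists h => // x; exact: le_trans (hf x) (fg x).
Qed.

Lemma le_limn_einf_near (R : realType) (u : (\bar R)^nat) (c : \bar R) :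
  (\forall n \near \oo, c <= u n)%E -> (c <= limn_einf u)%E.
Proof.
move=> [N _ cu]; rewrite limn_einf_lim; apply: lime_ge; first exact: is_cvg_einfs.
exists N => // n /= Nn; apply: le_ereal_inf_tmp => _ [m /= nm <-].
by apply: cu => /=; exact: leq_trans Nn nm.
Qed.

Section strong_type.
Context {R : realType}.
Local Notation mu := (@lebesgue_measure R).

(* No measurability is needed: the library's [lebesgue_measure] is an outer
   measure, defined on all sets. *)
Lemma le_lebesgue_measure (A B : set R) : A `<=` B -> (mu A <= mu B)%E.
Proof. by move=> AB; apply: (@le_mu_ext _ _ _ (wlength idfun)). Qed.

Definition big_part (a : R) (f : R -> R) (x : R) : R := f x * (a < `|f x|)%R%:R.

Let measurable_big_part (a : R) (f : R -> R) : measurable_fun setT f ->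
  measurable_fun setT (big_part a f).
Proof.
move=> mf; apply: measurable_funM => //.
rewrite (_ : (fun x => _) = \1_[set x | a < `|f x|]); last first.
  by apply/funext => x; rewrite indicE; congr (_%:R); congr nat_of_bool;
    apply/idP/idP; rewrite inE.
apply: measurable_indic.
rewrite -[X in measurable X]setTI.
exact: (measurable_fun_ltr (measurable_cst a)
  (measurableT_comp (@normr_measurable R setT) mf)).
Qed.

(** The part of [f] below a/2 contributes at most a/2 to any mean, so the maximal function of the
    big part must exceed a/2. The weak type inequality, with constant 3, at level a/2 gives 6/a. *)
Lemma HL_maximal_big_part (a : R) (f : R -> R) : 0 < a -> measurable_fun setT f ->
  (\int[mu]_x `|big_part (a / 2) f x|%:E < +oo)%E ->
  (mu [set x | a%:E < HL_maximal f x] <=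
    (6 / a)%:E * \int[mu]_x `|big_part (a / 2) f x|%:E)%E.
Proof.
move=> a0 mf intf.
set f1 := big_part (a / 2) f.
have a20 : 0 < a / 2 by rewrite divr_gt0.
have mf1 : measurable_fun setT f1 by exact: measurable_big_part.
have loc1 : locally_integrable setT f1.
  apply: open_integrable_locally; first exact: openT.
  by apply/integrableP; split => //; apply/measurable_EFinP.
have HLle x : (HL_maximal f x <= HL_maximal f1 x + (a / 2)%:E)%E.
  apply: ge_ereal_sup => z [r /=]; rewrite in_itv/= andbT => r0 <-{z}.
  have mB : measurable (ball x r : set R) by exact: measurable_ball.
  have Boo : (mu (ball x r) < +oo)%E by rewrite lebesgue_measure_ball ?ltry// ltW.
  have f12 : f = (f1 \+ (f \- f1))%R by apply/funext => z /=; rewrite addrC subrK.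
  rewrite f12; apply: (le_trans (iavgD mB Boo _ _)).
  - exact: measurable_funTS.
  - by apply: measurable_funTS; exact: measurable_funB.
  apply: leeD.
    by apply: ereal_sup_ubound; exists r => //; rewrite /= in_itv/= andbT.
  rewrite /iavg lebesgue_measure_ball ?(ltW r0)//.
  have r2 : 0 < r *+ 2 by rewrite pmulrn_lgt0.
  rewrite inver gt_eqF// lee_pdivrMl//.
  apply: (@le_trans _ _ (\int[mu]_(z in ball x r) (cst (a / 2)%:E) z)%E).
    apply: ge0_le_integral => //.
    - apply/measurable_EFinP; apply: measurable_funTS.
      by apply: measurableT_comp => //; exact: measurable_funB.
    - move=> z _; rewrite /= lee_fin /f1 /big_part.
      case: ltP => /= h; rewrite ?mulr1 ?subrr ?normr0 ?mulr0 ?subr0//.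
      exact: ltW.
  by rewrite integral_cst// -(lebesgue_measure_ball x (ltW r0)) muleC.
apply: (@le_trans _ _ (mu [set x | (a / 2)%:E < HL_maximal f1 x]%E)).
  apply: le_lebesgue_measure => x /= /lt_le_trans /(_ (HLle x)).
  rewrite -lteBlDr// -EFinB; congr (_%:E < _)%E.
  by field.
apply: (le_trans (maximal_inequality loc1 a20)).
rewrite le_eqVlt; apply/orP; left; apply/eqP; congr (_%:E * _)%E.
by field; rewrite gt_eqF.
Qed.

(** If the last term is below B, the whole geometric sum is at most q/(q - 1) times that term; if
    not, it is discarded and induction applies. *)
Let geometric_truncated_sum (w q B : R) n : 0 < w -> 1 < q -> 0 <= B ->
  \sum_(k < n) w * q ^+ k * (w * q ^+ k < B)%R%:R <= q / (q - 1) * B.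
Proof.
move=> w0 q1 B0.
have q0 : 0 < q by exact: lt_trans q1.
have q10 : 0 < q - 1 by rewrite subr_gt0.
have C0 : 0 <= q / (q - 1) by rewrite divr_ge0// ltW.
elim: n => [|n IH]; first by rewrite big_ord0 mulr_ge0.
have [wB|Bw] := ltP (w * q ^+ n) B; last first.
  by rewrite big_ord_recr/= ltNge Bw/= mulr0 addr0.
apply: (@le_trans _ _ (\sum_(k < n.+1) w * q ^+ k)).
  apply: ler_sum => k _; rewrite ler_piMr//; last by case: ltP.
  by rewrite mulr_ge0 ?exprn_ge0// ltW.
have S m : (q - 1) * \sum_(k < m) w * q ^+ k = w * q ^+ m - w.
  elim: m => [|m IHm]; first by rewrite big_ord0 mulr0 expr0 mulr1 subrr.
  by rewrite big_ord_recr/= mulrDr IHm exprS; ring.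
rewrite -(ler_pM2l q10) S mulrA (_ : (q - 1) * (q / (q - 1)) = q); last first.
  by field; rewrite gt_eqF.
rewrite exprS mulrCA; apply: (@le_trans _ _ (q * (w * q ^+ n))).
  by rewrite gerBl ltW.
by rewrite ler_pM2l// ltW.
Qed.

Let dyadic_layer (e : R) n : (2 ^+ n)^-1 < e -> e <= 2 ^+ n ->
  exists2 k, (k < n.*2)%N &
    (2 ^+ n)^-1 * 2 ^+ k < e /\ e <= 2 * ((2 ^+ n)^-1 * 2 ^+ k).
Proof.
move=> ne en.
have n0 : (0 < n)%N.
  case: n ne en => // ; rewrite expr0 invr1 => h1 h2.
  by have := lt_le_trans h1 h2; rewrite ltxx.
have p2 : 2 ^+ n != 0 :> R by rewrite gt_eqF// exprn_gt0.
(* The index 2n - 1 qualifies, as 2 2^(-n) 2^(2n-1) = 2^n. The least k that qualifies has the strict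
   lower bound by minimality, or by 2^(-n) < e when k = 0. *)
have ex : exists k, e <= 2 * ((2 ^+ n)^-1 * 2 ^+ k).
  exists n.*2.-1; rewrite mulrCA -exprS prednK ?double_gt0//.
  by rewrite -addnn exprD mulrA mulVf// mul1r.
case: (ex_minnP ex) => k ek kmin.
exists k.
  have : (k <= n.*2.-1)%N.
    apply: kmin; rewrite mulrCA -exprS prednK ?double_gt0//.
    by rewrite -addnn exprD mulrA mulVf// mul1r.
  by rewrite -ltnS prednK ?double_gt0.
split=> //; case: k ek kmin => [|k] ek kmin; first by rewrite expr0 mulr1.
rewrite ltNge; apply/negP => h.
have := kmin k; rewrite mulrCA -exprS => /(_ h).
by rewrite ltnn.
Qed.

(** * Dyadic interpolation at a fixed exponent *)

Section exponent.
Variable r : R.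
Hypothesis r1 : 1 < r.

Let r0 : 0 < r. Proof. exact: lt_trans r1. Qed.

Let rB0 : 0 < r - 1. Proof. by rewrite subr_gt0. Qed.

(** The growth of a^(r-1) when the level a doubles. That it exceeds 1 is where r > 1 enters the
    geometric sum. *)
Definition dyadic_ratio : R := 2 `^ (r - 1).

Let dyadic_ratio_gt1 : 1 < dyadic_ratio.
Proof.
rewrite /dyadic_ratio -[ltLHS](congr1 (@^~ (r - 1)) (powR1 R)).
apply: gt0_ltr_powR => //; rewrite ?nnegrE//.
by rewrite ltr1n.
Qed.

Let powR_pred (x : R) : 0 <= x -> x `^ r = x `^ (r - 1) * x.
Proof.
move=> x0; rewrite -{3}(powRr1 x0) -powRD ?subrK//.
by rewrite (gt_eqF r0).
Qed.

(** At level a, (2 a)^r (6 / a) = 12 (2 a)^(r-1), and a/2 < b means 2 a < 4 b, which gives the power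
    of 4; the quotient is the geometric sum. *)
Definition strong_const : R := 12 * (dyadic_ratio / (dyadic_ratio - 1) * 4 `^ (r - 1)).

Lemma strong_const_gt0 : 0 < strong_const.
Proof.
have q0 : 0 < dyadic_ratio by exact: lt_trans dyadic_ratio_gt1.
by rewrite !mulr_gt0 ?powR_gt0 ?invr_gt0 ?subr_gt0.
Qed.

(** With b = |f x| this is the interpolation estimate at a single point: only levels below 2 b
    count, and their geometric sum is comparable to its largest term. *)
Let layer_sum_le (eps b : R) n : 0 < eps -> 0 <= b ->
  \sum_(k < n) (2 * (eps * 2 ^+ k)) `^ r * (6 / (eps * 2 ^+ k)) *
    (b * (eps * 2 ^+ k / 2 < b)%R%:R) <= strong_const * b `^ r.
Proof.
move=> e0 b0.
pose w := (2 * eps) `^ (r - 1).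
have w0 : 0 < w by rewrite powR_gt0// mulr_gt0.
have wq k : (2 * (eps * 2 ^+ k)) `^ (r - 1) = w * dyadic_ratio ^+ k.
  rewrite mulrA powRM ?mulr_ge0 ?exprn_ge0// ?(ltW e0)//; congr (_ * _).
  by rewrite /dyadic_ratio -!powR_mulrn ?powR_ge0// -!powRrM mulrC.
pose B := (4 * b) `^ (r - 1).
have B0 : 0 <= B by exact: powR_ge0.
have le k : (2 * (eps * 2 ^+ k)) `^ r * (6 / (eps * 2 ^+ k)) *
    (b * (eps * 2 ^+ k / 2 < b)%R%:R) <=
    12 * b * (w * dyadic_ratio ^+ k * (w * dyadic_ratio ^+ k < B)%R%:R).
  have a0 : 0 < eps * 2 ^+ k by rewrite mulr_gt0// exprn_gt0.
  have e1 : eps != 0 by rewrite gt_eqF.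
  have e2 : 2 ^+ k != 0 :> R by rewrite gt_eqF// exprn_gt0.
  rewrite powR_pred; last by rewrite mulr_ge0// ltW.
  rewrite wq [leLHS](_ : _ =
    12 * b * (w * dyadic_ratio ^+ k * (eps * 2 ^+ k / 2 < b)%R%:R));
    last by field; rewrite ?e1 ?e2.
  have [h|_] := ltP (eps * 2 ^+ k / 2) b; last first.
    by rewrite !mulr0 !mulr_ge0// ?exprn_ge0 ?powR_ge0// ltW.
  suff -> : w * dyadic_ratio ^+ k < B by [].
  rewrite -wq /B; apply: gt0_ltr_powR => //; rewrite ?nnegrE.
  + by rewrite mulr_ge0// ltW.
  + by rewrite mulr_ge0.
  + by move: h; rewrite ltr_pdivrMr//; lra.
apply: (@le_trans _ _ (\sum_(k < n)
  12 * b * (w * dyadic_ratio ^+ k * (w * dyadic_ratio ^+ k < B)%R%:R))).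
  by apply: ler_sum => k _; exact: le.
rewrite -mulr_sumr.
have := geometric_truncated_sum w dyadic_ratio B n w0 dyadic_ratio_gt1 B0.
move/(ler_wpM2l (mulr_ge0 (ler0n R 12) b0)) => /le_trans; apply.
rewrite /B powRM// powR_pred// /strong_const le_eqVlt; apply/orP; left; apply/eqP.
by field; rewrite subr_eq0 gt_eqF.
Qed.

(** On a compact set |f| <= 1 + |f|^r, and the constant 1 is integrable there. *)
Lemma locally_integrable_powR (f : R -> R) : measurable_fun setT f ->
  (\int[mu]_x (`|f x| `^ r)%:E < +oo)%E -> locally_integrable setT f.
Proof.
move=> mf intf; split => //; first exact: openT.
move=> K _ cK.
have mK : measurable K by exact: compact_measurable.
have mfr : measurable_fun setT (fun x => `|f x| `^ r).
  apply: (@measurableT_comp _ _ _ _ _ _ (fun z => z `^ r)).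
    exact: measurable_powR.
  exact: measurableT_comp.
apply: (@le_lt_trans _ _ (\int[mu]_(x in K) (1%:E + (`|f x| `^ r)%:E))%E).
  apply: ge0_le_integral => //.
  - by apply/measurable_EFinP; apply: measurable_funTS; exact: measurableT_comp.
  - apply: emeasurable_funD; first exact: measurable_cst.
    by apply/measurable_EFinP; exact: measurable_funTS.
  - move=> x _; rewrite -EFinD lee_fin.
    have [h|h] := leP `|f x| 1; first by rewrite (le_trans h)// lerDl powR_ge0.
    rewrite -[leLHS]powRr1// (@le_trans _ _ (`|f x| `^ r))//.
      by apply: ler_powR; exact: ltW.
    by rewrite lerDr.
rewrite ge0_integralD//; last first.
  by apply/measurable_EFinP; exact: measurable_funTS.
rewrite integral_cst// mul1e lte_add_pinfty//; first exact: compact_finite_measure.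
apply: le_lt_trans intf; apply: ge0_subset_integral => //.
by apply/measurable_EFinP.
Qed.

(** The power of the maximal function is bounded by step functions over dyadic levels, the weak type
    inequality is applied at each level a to the part of [f] above a/2, and Fatou removes the
    truncation to levels between 2^(-n) and 2^n. *)
Lemma HL_maximal_strong_type (f : R -> R) : measurable_fun setT f ->
  (\int[mu]_x (`|f x| `^ r)%:E < +oo)%E ->
  (\int[mu]_x (HL_maximal f x `^ r) <=
    strong_const%:E * \int[mu]_x (`|f x| `^ r)%:E)%E.
Proof.
move=> mf intf.
have mfr : measurable_fun setT (fun x => `|f x| `^ r).
  apply: (@measurableT_comp _ _ _ _ _ _ (fun z => z `^ r)).
    exact: measurable_powR.
  exact: measurableT_comp.
have locf := locally_integrable_powR f mf intf.
have mHL := measurable_HL_maximal locf.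
(* Where |f| > a/2 one has |f| <= (a/2)^(1-r) |f|^r. *)
have intbig (a : R) : 0 < a -> (\int[mu]_x `|big_part (a / 2) f x|%:E < +oo)%E.
  move=> a0; have a20 : 0 < a / 2 by rewrite divr_gt0.
  have c0 : 0 < (a / 2) `^ (r - 1) by rewrite powR_gt0.
  apply: (@le_lt_trans _ _
      (\int[mu]_x (((a / 2) `^ (r - 1))^-1%:E * (`|f x| `^ r)%:E))%E).
    apply: ge0_le_integral => //.
    - apply/measurable_EFinP; apply: measurableT_comp => //.
      exact: measurable_big_part.
    - by apply/measurable_EFinP; exact: measurable_funM.
    - move=> x _; rewrite -EFinM lee_fin /big_part.
      have [h|h] := ltP (a / 2) `|f x|; last first.
        by rewrite mulr0 normr0 mulr_ge0 ?powR_ge0// invr_ge0 ltW.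
      rewrite mulr1 ler_pdivlMl// powR_pred//; apply: ler_wpM2r => //.
      apply: ge0_ler_powR; rewrite ?nnegrE// ltW//.
  rewrite ge0_integralZl//.
  - rewrite lte_mul_pinfty//; first by rewrite lee_fin invr_ge0 ltW.
  - by apply/measurable_EFinP.
  - by rewrite lee_fin invr_ge0 ltW.
pose a (n k : nat) : R := (2 ^+ n)^-1 * 2 ^+ k.
have a0 n k : 0 < a n k by rewrite mulr_gt0 ?invr_gt0 ?exprn_gt0.
pose A n k : set R := [set x | ((a n k)%:E < HL_maximal f x)%E].
have mA n k : measurable (A n k).
  by rewrite -[X in measurable X]setTI; exact: emeasurable_fun_o_infty.
pose c n k : R := (2 * a n k) `^ r.
have c0 n k : 0 <= c n k by exact: powR_ge0.
(* The sum may overcount; all that matters below is that a single term bounds the r-th power of a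
   value lying between a and 2 a. *)
pose G n (x : R) : \bar R := (\sum_(k < n.*2) (c n k * \1_(A n k) x)%:E)%E.
have mcA n k : measurable_fun setT (fun x => (c n k * \1_(A n k) x)%:E).
  by apply/measurable_EFinP; apply: measurable_funM => //; exact: measurable_indic.
have mG n : measurable_fun setT (G n).
  by apply: emeasurable_sum => k; exact: mcA.
have cA0 n k x : (0 <= (c n k * \1_(A n k) x)%:E)%E.
  by rewrite lee_fin mulr_ge0// indicE.
have G0 n x : (0 <= G n x)%E by apply: sume_ge0 => k _; exact: cA0.
have Gint n : (\int[mu]_x G n x <=
    strong_const%:E * \int[mu]_x (`|f x| `^ r)%:E)%E.
  rewrite /G ge0_integral_sum//; last by move=> k; exact: mcA.
  apply: (@le_trans _ _ (\sum_(k < n.*2) \int[mu]_x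
      (c n k * (6 / a n k) * (`|f x| * (a n k / 2 < `|f x|)%R%:R))%:E)%E).
    apply: lee_sum => k _.
    under eq_integral do rewrite EFinM.
    rewrite ge0_integralZl//; last 2 first.
    - by apply/measurable_EFinP; apply: measurable_indic; exact: mA.
    - by rewrite lee_fin.
    rewrite integral_indic//; last exact: mA.
    rewrite setIT.
    apply: (@le_trans _ _ ((c n k)%:E * ((6 / a n k)%:E *
        \int[mu]_x `|big_part (a n k / 2) f x|%:E))%E).
      apply: lee_wpmul2l; first by rewrite lee_fin.
      by apply: HL_maximal_big_part => //; exact: intbig.
    rewrite muleA -EFinM -ge0_integralZl//; last 2 first.
    - apply/measurable_EFinP; apply: measurableT_comp => //.
      exact: measurable_big_part.
    - by rewrite lee_fin mulr_ge0// divr_ge0// ltW.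
    rewrite le_eqVlt; apply/orP; left; apply/eqP; apply: eq_integral => x _.
    rewrite -EFinM; congr EFin; congr (_ * _).
    by rewrite /big_part normrM [X in _ * X]ger0_norm.
  (* Back under one integral, the sum over levels can be estimated pointwise by [layer_sum_le]. *)
  rewrite -ge0_integral_sum//; last 2 first.
  - move=> k; apply/measurable_EFinP; apply: measurable_funM => //.
    have := measurable_big_part (a n k / 2) f mf.
    move=> /(measurableT_comp (@normr_measurable R setT)).
    rewrite (_ : _ \o _ = fun x => `|f x| * (a n k / 2 < `|f x|)%R%:R)//.
    by apply/funext => x /=; rewrite /big_part normrM [X in _ * X]ger0_norm.
  - move=> k x _; rewrite lee_fin !mulr_ge0// ?invr_ge0 ?(ltW (a0 _ _))//.
  rewrite -ge0_integralZl//; last 2 first.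
  - by apply/measurable_EFinP.
  - by rewrite lee_fin ltW// strong_const_gt0.
  apply: ge0_le_integral_nonmeasurable => x.
    by apply: sume_ge0 => k _; rewrite lee_fin !mulr_ge0// ?invr_ge0 ?(ltW (a0 _ _)).
  rewrite sumEFin -EFinM lee_fin.
  by apply: layer_sum_le => //; rewrite invr_gt0 exprn_gt0.
have Glow n k x : (k < n.*2)%N -> A n k x -> ((c n k)%:E <= G n x)%E.
  move=> kn Ax; rewrite /G (bigD1 (Ordinal kn))//= indicE mem_set// mulr1.
  by rewrite leeDl// sume_ge0// => j _; exact: cA0.
have lim x : (HL_maximal f x `^ r <= limn_einf (G ^~ x))%E.
  have H0 := HL_maximal_ge0T f x.
  case HE : (HL_maximal f x) => [e| |]; last by rewrite HE in H0.
  - have e0 : 0 <= e by rewrite HE lee_fin in H0.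
    have [->|en0] := eqVneq e 0.
      rewrite poweR0r ?gt_eqF//; apply: le_limn_einf_near.
      by apply: nearW => n; exact: G0.
    have ep : 0 < e by rewrite lt_neqAle eq_sym en0.
    rewrite poweR_EFin; apply: le_limn_einf_near.
    near=> n.
    have [|| k kn [k1 k2]] := dyadic_layer e n.
    + rewrite invf_plt ?posrE ?exprn_gt0//.
      apply: (@lt_le_trans _ _ n.+1%:R).
        near: n; exists (Num.truncn e^-1) => //= n /= hn.
        by rewrite (lt_le_trans (truncnS_gt _))// ler_nat; exact: hn.
      by rewrite -natrX ler_nat; exact: ltn_expl.
    + apply: (@le_trans _ _ n.+1%:R).
        near: n; exists (Num.truncn e) => //= n /= hn.
        by rewrite (le_trans (ltW (truncnS_gt _)))// ler_nat; exact: hn.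
      by rewrite -natrX ler_nat; exact: ltn_expl.
    apply: le_trans (Glow n k x kn _); last by rewrite /A /= HE lte_fin.
    rewrite lee_fin; apply: ge0_ler_powR; rewrite ?nnegrE//; first exact: ltW.
    by rewrite mulr_ge0// ltW.
  (* At an infinite value every level is exceeded; the top one, k = 2n - 1, alone contributes
     (2^n)^r >= 2^n, which is unbounded in n. *)
  - rewrite poweRyr ?gt_eqF// leye_eq; apply/eqP/eqyP => M M0.
    have [m hm] : exists m : nat, M <= m%:R.
      by exists (Num.truncn M).+1; rewrite ltW// truncnS_gt.
    apply: le_limn_einf_near; near=> n.
    have n1 : (0 < n)%N by near: n; exists 1%N.
    have kn : (n.*2.-1 < n.*2)%N by rewrite prednK ?double_gt0.
    apply: le_trans (Glow n n.*2.-1 x kn _); last by rewrite /A /= HE ltry.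
    rewrite lee_fin /c /a mulrCA -exprS prednK ?double_gt0//.
    rewrite -addnn exprD mulrA mulVf ?mul1r ?gt_eqF ?exprn_gt0//.
    apply: (@le_trans _ _ (2 ^+ n)).
      rewrite (le_trans hm)// -natrX ler_nat.
      apply: (@leq_trans n); last exact: ltnW (ltn_expl _ _).
      by near: n; exists m.
    rewrite -[leLHS]powRr1 ?exprn_ge0//; apply: ler_powR; last exact: ltW.
    by rewrite exprn_ege1// ler1n.
apply: (@le_trans _ _ (\int[mu]_x limn_einf (G ^~ x))%E).
  apply: ge0_le_integral_nonmeasurable; last exact: lim.
  by move=> x; exact: poweR_ge0.
apply: (le_trans (fatou _ _ _ _)) => //.
rewrite -[leRHS](cvg_limn_einf_sup (cvg_cst _)).1.
exact: le_limn_einf.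
Unshelve. all: by end_near. Qed.

End exponent.

End strong_type.

(** * Weak and strong bounds for the stable maximal operator *)

Theorem theorem2p2 (R : realType) (L : R -> R -> R)
  (HL : forall s : R, 0 < s -> s < 2 -> is_stable_density s (L s)) :
  (* weak type (1,1) *)
  (exists C : R, 0 < C /\
     forall f : R -> R, measurable_fun setT f ->
       (\int[lebesgue_measure]_x `|f x|%:E < +oo)%E ->
       forall lam : R, 0 < lam ->
         (lebesgue_measure [set x | lam%:E < Lstar L f x]
            <= (C / lam)%:E * \int[lebesgue_measure]_x `|f x|%:E)%E) /\
  (* bounded on L^p for 1 < p <= oo *)
  (forall p : \bar R, (1 < p)%E ->
     exists C : R, 0 < C /\
       forall f : R -> R, measurable_fun setT f ->
         (Lnorm lebesgue_measure p (EFin \o f) < +oo)%E ->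
         (Lnorm lebesgue_measure p (Lstar L f)
            <= C%:E * Lnorm lebesgue_measure p (EFin \o f))%E).
Proof.
have A0 := @stable_const_gt0 R; set A := stable_const in A0.
split.
  (* 3 is the constant of the Hardy-Littlewood weak type inequality, used at level lam / A. *)
  exists (3 * A); split; first by rewrite mulr_gt0.
  move=> f mf intf lam lam0.
  have locf : locally_integrable setT f.
    apply: open_integrable_locally; first exact: openT.
    by apply/integrableP; split => //; apply/measurable_EFinP.
  apply: (@le_trans _ _
      (lebesgue_measure [set x | (A^-1 * lam)%:E < HL_maximal f x]%E)).
    apply: le_lebesgue_measure => x /= hx.
    rewrite EFinM lte_pdivrMl//.
    exact: lt_le_trans hx (Lstar_le_HL_maximal L HL f x mf).
  have c0 : 0 < A^-1 * lam by rewrite mulr_gt0// invr_gt0.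
  apply: (le_trans (maximal_inequality locf c0)).
  rewrite le_eqVlt; apply/orP; left; apply/eqP; congr (_%:E * _)%E.
  by field; rewrite !gt_eqF.
case=> [r| |]; last by rewrite ltNge leNye.
- rewrite lte_fin => r1.
  have r0 : 0 < r by exact: lt_trans r1.
  have C0 := strong_const_gt0 r r1.
  (* The r-th root of A^r [strong_const r], the constant for the integrals of r-th powers. *)
  exists (A * strong_const r `^ r^-1); split; first by rewrite mulr_gt0// powR_gt0.
  move=> f mf; rewrite unlock => /lty_poweRy intf.
  have {}intf : (\int[lebesgue_measure]_x (`|f x| `^ r)%:E < +oo)%E.
    by apply: intf; rewrite invr_eq0 gt_eqF.
  have mHL := measurable_HL_maximal (locally_integrable_powR r r1 f mf intf).
  have step : (\int[lebesgue_measure]_x (`|Lstar L f x| `^ r) <=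
      (A `^ r * strong_const r)%:E * \int[lebesgue_measure]_x (`|f x| `^ r)%:E)%E.
    apply: (@le_trans _ _ (\int[lebesgue_measure]_x
        ((A `^ r)%:E * HL_maximal f x `^ r))%E).
      apply: ge0_le_integral_nonmeasurable => x; first exact: poweR_ge0.
      rewrite gee0_abs ?Lstar_ge0// -poweR_EFin -poweRM ?HL_maximal_ge0T ?lee_fin ?(ltW A0)//.
      apply: gt0_ler_poweR; first exact: ltW.
      + by rewrite in_itv/= Lstar_ge0 leey.
      + by rewrite in_itv/= leey andbT mule_ge0 ?HL_maximal_ge0T// lee_fin ltW.
      + exact: Lstar_le_HL_maximal.
    have -> : (\int[lebesgue_measure]_x ((A `^ r)%:E * HL_maximal f x `^ r) =
        (A `^ r)%:E * \int[lebesgue_measure]_x (HL_maximal f x `^ r))%E.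
      apply: ge0_integralZl => //.
      + exact: (measurableT_comp (measurable_poweR _)).
      + by move=> x _; exact: poweR_ge0.
      + by rewrite lee_fin powR_ge0.
    rewrite EFinM -muleA; apply: lee_wpmul2l; first by rewrite lee_fin powR_ge0.
    exact: HL_maximal_strong_type.
  have I0 : (0 <= \int[lebesgue_measure]_x (`|f x| `^ r)%:E)%E.
    by apply: integral_ge0 => x _; rewrite lee_fin powR_ge0.
  apply: (@le_trans _ _ (((A `^ r * strong_const r)%:E *
      \int[lebesgue_measure]_x (`|f x| `^ r)%:E) `^ r^-1)%E).
    apply: gt0_ler_poweR => //; first by rewrite invr_ge0 ltW.
    + by rewrite in_itv/= leey andbT; apply: integral_ge0 => x _; exact: poweR_ge0.
    + by rewrite in_itv/= leey andbT mule_ge0// lee_fin mulr_ge0 ?powR_ge0// ltW.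
  rewrite poweRM//; last by rewrite lee_fin mulr_ge0 ?powR_ge0// ltW.
  rewrite poweR_EFin powRM ?powR_ge0// ?(ltW C0)// -powRrM divff ?gt_eqF//.
  by rewrite powRr1 ?(ltW A0).
- move=> _; exists A; split => // f mf; rewrite unlock.
  (* The norm at infinity is an essential supremum only on a space of positive measure; this selects
     that branch of its definition. *)
  have mu0 : (0 < lebesgue_measure [set: R])%E.
    apply: (@lt_le_trans _ _ (lebesgue_measure (ball (0:R) 1))).
      by rewrite lebesgue_measure_ball// lte_fin.
    exact: le_lebesgue_measure.
  rewrite mu0 => _.
  pose M : \bar R := ess_sup (@lebesgue_measure R) (abse \o (EFin \o f)).
  have fM := ess_sup_ge (@lebesgue_measure R) (abse \o (EFin \o f)).
  (* This holds at every x: |f| <= M almost everywhere already bounds each mean. *)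
  have HLM x : (HL_maximal f x <= M)%E.
    apply: ge_ereal_sup => z [d /=]; rewrite in_itv/= andbT => d0 <-{z}.
    have d2 : 0 < d *+ 2 by rewrite pmulrn_lgt0.
    rewrite /iavg lebesgue_measure_ball ?(ltW d0)// inver gt_eqF// lee_pdivrMl//.
    apply: (@le_trans _ _ (\int[lebesgue_measure]_(t in ball x d) cst M t)%E).
      have M0 : (0 <= M)%E.
        by apply: ess_sup_gee => //; apply: nearW => t; exact: abse_ge0.
      apply: ae_ge0_le_integral => //.
      - exact: measurable_ball.
      - apply/measurable_EFinP; apply: measurable_funTS.
        exact: measurableT_comp.
      - apply: (@filterS _ _ (ae_filter_ringOfSetsType lebesgue_measure)) fM.
        by move=> t.
    rewrite integral_cst//; last exact: measurable_ball.
    by rewrite -(lebesgue_measure_ball x (ltW d0)) muleC.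
  apply/ess_supP; apply: nearW => x /=.
  rewrite gee0_abs ?Lstar_ge0//.
  apply: (le_trans (Lstar_le_HL_maximal L HL f x mf)).
  by apply: lee_wpmul2l; [rewrite lee_fin ltW|exact: HLM].
Qed.
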